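(* There is a set $K\subseteq\mathbb{R}^2$ of ee-measure $0$ that contains arbitrarily long line segments in every direction in $\mathbb{R}^2$. Hence for every nonzero vector $\mathbf{v}\in\mathbb{R}^2$ and every $L>0$ there is a line segment of length at least $L$ parallel to $\mathbf{v}$ that contains no ee-random point.
   Context: For $r\in\mathbb{N}$, $\mathbf{u}\in\mathbb{Z}^2$, $Q_r(\mathbf{u})=[u_12^{-r},(u_1+1)2^{-r})\times[u_22^{-r},(u_2+1)2^{-r})$; $\mathcal{Q}_r=\{Q_r(\mathbf{u}):\mathbf{u}\in\{0,\dots,2^r-1\}^2\}$, $\mathcal{Q}=\bigcup_r\mathcal{Q}_r$. A martingale is $d:\mathcal{Q}\to[0,\infty)$ with $d(Q_r(\mathbf{u}))=\frac14\sum_{\mathbf{a}\in\{0,1\}^2}d(Q_{r+1}(2\mathbf{u}+\mathbf{a}))$. For $\mathbf{x}\in[0,1)^2$, $d^{(r)}(\mathbf{x})=d(Q)$ for the $Q\in\mathcal{Q}_r$ containing $\mathbf{x}$; $d$ succeeds at $\mathbf{x}$ if $\limsup_r d^{(r)}(\mathbf{x})=\infty$. Let $J=\{(r,\mathbf{u}):r\in\mathbb{N},\mathbf{u}\in\{0,\dots,2^r-1\}^2\}$. $d$ is ee-computable if there is $\widehat d:\mathbb{N}\times J\to\mathbb{Q}\cap[0,\infty)$, computable in time $2^{2^{O(s+r)}}$, with $|\widehat d(s,r,\mathbf{u})-d(Q_r(\mathbf{u}))|\le2^{-s}$ for all $(s,r,\mathbf{u})$. For $E\subseteq\mathbb{R}^2$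 let $E^\#=[0,1)^2\cap\bigcup_{\mathbf{t}\in\mathbb{Z}^2}(E+\mathbf{t})$; $E$ has ee-measure $0$ if some ee-computable martingale succeeds at every point of $E^\#$. A point $\mathbf{x}\in\mathbb{R}^2$ is ee-random if no ee-computable martingale succeeds at it (equivalently for points of $[0,1)^2$; for general $\mathbf{x}$, at its translate into $[0,1)^2$ by an integer vector), i.e., $\mathbf{x}$ belongs to no set of ee-measure $0$. *)

(* Defs.v *)
From HB Require Import structures.
From mathcomp Require Import all_boot all_order all_algebra.
From mathcomp Require Import all_classical all_reals all_analysis.

Set Implicit Arguments.
Unset Strict Implicit.
Unset Printing Implicit Defensive.

Import Order.TTheory GRing.Theory Num.Theory.

Local Open Scope classical_set_scope.
Local Open Scope ring_scope.

(* Deterministic multi-tape Turing machines.  Input and output words are over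
   the alphabet {0, 1, #}: [Some b] is the bit b and [None] is the separator #.
   A tape cell holds [None] (the blank), an input/output symbol, or a symbol of
   the work alphabet of the machine. *)

Definition symbol := option bool.
Definition cell (W : Type) := option (symbol + W).

Inductive move := MoveLeft | Stay | MoveRight.

Record machine := Machine {
  extra_tapes : nat;      (* the machine has [extra_tapes.+1] tapes *)
  work : finType;
  state : finType;
  start : state;
  final : pred state;
  trans : state -> {ffun 'I_extra_tapes.+1 -> cell work} ->
          state * {ffun 'I_extra_tapes.+1 -> cell work * move}
}.

(* A two-way infinite tape, blank outside of the two lists; [before] lists the
   cells on the left of the head, the nearest one first. *)
Record tape (W : Type) := Tape {
  before : seq (cell W);
  scanned : cell W;
  after : seq (cell W)
}.

Definition shift W (m : move) (t : tape W) : tape W :=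
  match m with
  | MoveLeft => Tape (behead (before t)) (head None (before t))
                     (scanned t :: after t)
  | Stay => t
  | MoveRight => Tape (scanned t :: before t) (head None (after t))
                      (behead (after t))
  end.

Definition write W (x : cell W) (t : tape W) : tape W :=
  Tape (before t) x (after t).

Definition config (M : machine) : Type :=
  state M * ('I_(extra_tapes M).+1 -> tape (work M)).

Definition step (M : machine) (c : config M) : config M :=
  if final c.1 then c else
  let a := trans c.1 [ffun i => scanned (c.2 i)] in
  (a.1, fun i => shift (a.2 i).2 (write (a.2 i).1 (c.2 i))).

Definition word_tape W (w : seq symbol) : tape W :=
  let s := [seq Some (inl x) : cell W | x <- w] in
  Tape [::] (head None s) (behead s).

Definition init (M : machine) (w : seq symbol) : config M :=
  (start M, fun i => word_tape (work M) (if i == ord0 then w else [::])).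

(* The longest word over {0, 1, #} starting at the head. *)
Fixpoint word_prefix W (s : seq (cell W)) : seq symbol :=
  if s is Some (inl x) :: s' then x :: word_prefix s' else [::].

Definition tape_word W (t : tape W) : seq symbol :=
  word_prefix (scanned t :: after t).

(* [M] started on input [w] halts after at most [T] steps and outputs [w']. *)
Definition runs_to (M : machine) (w : seq symbol) (T : nat) (w' : seq symbol) :
    Prop :=
  let c := iter T (@step M) (init M w) in
  final c.1 /\ tape_word (c.2 ord0) = w'.

(* Binary numerals, least significant bit first. *)
Definition bits (n : nat) : seq bool :=
  mkseq (fun i => odd (n %/ 2 ^ i)) (up_log 2 n.+1).

Definition bits_val (s : seq bool) : nat :=
  foldr (fun (b : bool) n => (b + n.*2)%N) 0%N s.

(* The input word bin(n_1) # bin(n_2) # ... bin(n_k) #. *)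
Definition encode_input (ns : seq nat) : seq symbol :=
  flatten [seq rcons (map Some (bits n)) None | n <- ns].

(* The word bin(a) # bin(b) denotes the nonnegative rational a / b, where b is
   nonzero; the fraction need not be in lowest terms, and leading zeros are
   allowed. *)
Definition denotes_rat (w : seq symbol) (q : rat) : Prop :=
  exists a b : seq bool,
    [/\ w = map Some a ++ None :: map Some b,
        bits_val b != 0%N &
        q = (bits_val a)%:R / (bits_val b)%:R].

Definition J (r : nat) : set (nat * nat) :=
  [set u | (u.1 < 2 ^ r)%N /\ (u.2 < 2 ^ r)%N].

(* Computability in time 2^(2^(O(s+r))); the successor makes the O-bound
   meaningful for s = r = 0. *)
Definition ee_time_computable (f : nat -> nat -> nat * nat -> rat) : Prop :=
  exists (M : machine) (c : nat), forall s r u, J r u ->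
    exists w : seq symbol,
      runs_to M (encode_input [:: s; r; u.1; u.2])
        (2 ^ (2 ^ (c * (s + r).+1)))%N w /\
      denotes_rat w (f s r u).

Section Plane.
Variable R : realType.
Implicit Types (x p q v : R * R) (d : set (R * R) -> R).

Definition cube (r : nat) (u : nat * nat) : set (R * R) :=
  [set x | (u.1%:R / 2 ^+ r <= x.1 < (u.1.+1)%:R / 2 ^+ r) /\
           (u.2%:R / 2 ^+ r <= x.2 < (u.2.+1)%:R / 2 ^+ r)].

Definition cubes (r : nat) : set (set (R * R)) :=
  [set cube r u | u in J r].

(* A martingale is a function on the dyadic cubes of [0,1)^2; the values of [d]
   at other sets are irrelevant. *)
Definition martingale d : Prop :=
  (forall r Q, cubes r Q -> 0 <= d Q) /\
  (forall r u, J r u ->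
     d (cube r u) = 4^-1 * \sum_(a : bool * bool)
       d (cube r.+1 (2 * u.1 + a.1, 2 * u.2 + a.2)%N)).

Definition value_at d (r : nat) x : R :=
  d (xget set0 [set Q | cubes r Q /\ Q x]).

Definition succeeds d x : Prop :=
  limn_esup (fun r => (value_at d r x)%:E) = +oo%E.

Definition ee_computable d : Prop :=
  exists dhat : nat -> nat -> nat * nat -> rat,
    ee_time_computable dhat /\
    (forall s r u, J r u -> 0 <= dhat s r u) /\
    (forall s r u, J r u ->
       `| ratr (dhat s r u) - d (cube r u) | <= (2 ^+ s)^-1).

Definition unit_square : set (R * R) :=
  [set x | (0 <= x.1 < 1) /\ (0 <= x.2 < 1)].

Definition translate x (t : int * int) : R * R :=
  (x.1 + t.1%:~R, x.2 + t.2%:~R).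

Definition sharp (E : set (R * R)) : set (R * R) :=
  unit_square `&` \bigcup_(t in [set: int * int]) [set translate x t | x in E].

Definition ee_null (E : set (R * R)) : Prop :=
  exists d, [/\ martingale d, ee_computable d &
                forall x, sharp E x -> succeeds d x].

Definition to_unit_square x : R * R :=
  translate x (- Num.floor x.1, - Num.floor x.2).

Definition ee_random x : Prop :=
  ~ exists d, [/\ martingale d, ee_computable d &
                  succeeds d (to_unit_square x)].

Definition segment p q : set (R * R) :=
  [set ((1 - t) * p.1 + t * q.1, (1 - t) * p.2 + t * q.2) | t in `[0, 1]].

(* The norm of the library on [R * R] is the max norm, hence this definition. *)
Definition segment_length p q : R :=
  Num.sqrt ((q.1 - p.1) ^+ 2 + (q.2 - p.2) ^+ 2).

Definition segment_parallel p q v : Prop :=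
  exists c : R, q.1 - p.1 = c * v.1 /\ q.2 - p.2 = c * v.2.

End Plane.

(* Main.v *)
Require Import Defs.
From HB Require Import structures.
From mathcomp Require Import all_boot all_order all_algebra.
From mathcomp Require Import all_classical all_reals all_analysis.
From mathcomp Require Import zify ring lra.

Set Implicit Arguments.
Unset Strict Implicit.
Unset Printing Implicit Defensive.

Import Order.TTheory GRing.Theory Num.Theory.
Import numFieldNormedType.Exports.

(** Cut the binary expansion of a slope [a] in [0, 1] into blocks, block [i]
    being the integer [a_i < 2^(2i+1)] made of the digits up to place [(i+1)^2],
    and choose points [x_i >= 0].  Let [y_a] be the line of slope [a] that is
    the sum over [i] of [a_i 2^(-(i+1)^2) (t - x_i)].  When [t] is within
    [2^-p] of [x_k], block [k] moves [y_a t] by at most [2^(-k^2-p)] only and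
    the later blocks are negligible, so that the [2^(k^2)] possible beginnings
    of [a] confine [(t, y_a t)] to [O(4^(k^2))] dyadic squares of side
    [2^(-k^2-p)], whatever [a] is; their total area is [O(4^-p)].  With
    [p = 3l] for [16^l <= k < 16^(l+1)] and [x_k = (k - 16^l) / 8^l], every
    [t >= 0] is close to [x_k] for infinitely many [k], whereas the areas have
    a finite sum.  Hence [d(Q)], the sum over all these squares of their
    relative density in [Q], is a martingale that succeeds at every point
    lying in infinitely many of the squares.  The points
    [(+- y_a t, t - y_a t)] form half-lines in all directions, up to sign.

    The stages [k < 16^(s+r+7)] determine [d] on squares of side [2^-r] up to
    [2^-s].  They are summed by brute force on numbers bounded by
    [2^(2^O(s+r))] that are stored in unary, which takes a polynomial time in
    that bound.  *)

(** * Turing machines from structured commands *)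

(** The base 16 is a compromise. With levels [N^l <= k < N^(l+1)] and [p = 3l], the points [x_k] are
    [8^-l] apart and reach about [(N/8)^l], while the areas of level [l] add up to [O((N/64)^l)]:
    this asks for [8 < N < 64], and a power of 2 keeps everything dyadic. Blocks of length [2i+1]
    end at perfect squares and outgrow [p], which is logarithmic in [k]; hence the blocks after [k]
    do not show at scale [2^(-k^2-p)], although the [x_i] are unbounded. The half-lines have
    direction [(+- a, 1 - a)], on the unit circle of the sum norm, so slopes in [0, 1] and two signs
    reach steep directions too. A square may be counted several times; this only enlarges [d]. On
    the machine side the time bound is generous enough for a small expression language in which a
    single bound [B] on all intermediate values controls the time. What remains is to bound values,
    with exponents that do not depend on the input. *)

Notation tcell := (cell unit).
Notation ttape := (tape unit).

Definition marker : tcell := Some (inr tt).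

Inductive cmd :=
| Act of nat & (tcell -> tcell * move)
| Seq of cmd & cmd
| While of nat & pred tcell & cmd.

Definition act (f : tcell -> tcell * move) (t : ttape) : ttape :=
  Defs.shift (f (scanned t)).2 (write (f (scanned t)).1 t).

Definition upd (T : Type) (g : nat -> T) (i : nat) (x : T) : nat -> T :=
  fun j => if j == i then x else g j.

Inductive exec : cmd -> nat -> (nat -> ttape) -> (nat -> ttape) -> Prop :=
| exec_act i f g : exec (Act i f) 1 g (upd g i (act f (g i)))
| exec_seq a b t1 t2 g1 g2 g3 :
    exec a t1 g1 g2 -> exec b t2 g2 g3 -> exec (Seq a b) (t1 + t2) g1 g3
| exec_stop i (p : pred tcell) a g : ~~ p (scanned (g i)) -> exec (While i p a) 1 g g
| exec_loop i (p : pred tcell) a t1 t2 g1 g2 g3 :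
    p (scanned (g1 i)) -> exec a t1 g1 g2 -> exec (While i p a) t2 g2 g3 ->
    exec (While i p a) (t1 + t2).+1 g1 g3.

Fixpoint max_index (c : cmd) : nat :=
  match c with
  | Act i _ => i
  | Seq a b => maxn (max_index a) (max_index b)
  | While i _ a => maxn i (max_index a)
  end.

(** * Compilation of commands into Turing machines *)

Section Compilation.
Variable n : nat.

Local Notation cells := {ffun 'I_n.+1 -> tcell}.
Local Notation acts := {ffun 'I_n.+1 -> tcell * move}.
Local Notation tapes := ('I_n.+1 -> ttape).

Fixpoint cstate (c : cmd) : finType :=
  match c with
  | Act _ _ => unit
  | Seq a b => (cstate a + cstate b)%type
  | While _ _ a => option (cstate a)
  end.

Fixpoint cstart (c : cmd) : cstate c :=
  match c return cstate c with
  | Act _ _ => tt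
  | Seq a b => inl (cstart a)
  | While _ _ a => None
  end.

Definition idle (x : cells) : acts := [ffun i => (x i, Stay)].

(** A returned control [None] means that the command is finished. [Seq] enters its second part
    within the same step, so that times add exactly; for [While], the state [None] is the test,
    which takes one idle step. *)
Fixpoint ctrans (c : cmd) : cstate c -> cells -> option (cstate c) * acts :=
  match c return cstate c -> cells -> option (cstate c) * acts with
  | Act i f => fun _ x =>
      (None, [ffun j => if j == inord i then f (x j) else (x j, Stay)])
  | Seq a b => fun s x =>
      match s with
      | inl s' => let r := ctrans s' x in
          (Some (if r.1 is Some s1 then inl s1 else inr (cstart b)), r.2)
      | inr s' => let r := ctrans s' x in (omap inr r.1, r.2)
      end
  | While i p a => fun s x =>
      match s with
      | None => (if p (x (inord i)) then Some (Some (cstart a)) else None,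
                 idle x)
      | Some s' => let r := ctrans s' x in (Some r.1, r.2)
      end
  end.

Definition apply_acts (a : acts) (g : tapes) : tapes :=
  fun i => Defs.shift (a i).2 (write (a i).1 (g i)).

Definition heads (g : tapes) : cells := [ffun i => scanned (g i)].

(* [goes t s g g']: the control [s] is left for the first time after exactly
   [t] steps. *)
Fixpoint goes (c : cmd) (t : nat) (s : cstate c) (g g' : tapes) : Prop :=
  if t is t'.+1 then
    let r := ctrans s (heads g) in
    let g1 := apply_acts r.2 g in
    if r.1 is Some s' then goes t' s' g1 g' else t' = 0 /\ g1 = g'
  else False.

Lemma goes_seqr a b t s g1 g2 :
  goes t s g1 g2 -> goes (c := Seq a b) t (inr s) g1 g2.
Proof.
elim: t s g1 => [s g1 []|t IH] s g1 /=.
by case: (ctrans s (heads g1)) => [[s'|] x] //=; apply: IH.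
Qed.

Lemma goes_seql a b t1 t2 s g1 g2 g3 :
  goes t1 s g1 g2 -> goes t2 (cstart b) g2 g3 ->
  goes (c := Seq a b) (t1 + t2) (inl s) g1 g3.
Proof.
elim: t1 s g1 => [s g1 []|t1 IH] s g1 /=.
case: (ctrans s (heads g1)) => [[s'|] x] /=; first by move=> /IH; apply.
by move=> [-> ->]; rewrite add0n; apply: goes_seqr.
Qed.

Lemma goes_while i p a t1 t2 s g1 g2 g3 :
  goes t1 s g1 g2 -> goes (c := While i p a) t2 None g2 g3 ->
  goes (c := While i p a) (t1 + t2) (Some s) g1 g3.
Proof.
elim: t1 s g1 => [s g1 []|t1 IH] s g1 /=.
case: (ctrans s (heads g1)) => [[s'|] x] /=; first by move=> /IH; apply.
by move=> [-> ->]; rewrite add0n.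
Qed.

Definition restrict (g : nat -> ttape) : tapes := fun i => g i.

Lemma apply_idle g : apply_acts (idle (heads g)) g = g.
Proof.
apply/funext => i; rewrite /apply_acts /idle /heads !ffunE /=.
by case: (g i).
Qed.

(** The bound on [max_index] makes [inord i] the intended tape: an index above [n] would be sent to
    tape 0. *)
Lemma exec_goes c t g g' : exec c t g g' -> max_index c <= n ->
  goes t (cstart c) (restrict g) (restrict g').
Proof.
elim=> {c t g g'} /=.
- move=> i f g le_in; split=> //; apply/funext => j.
  rewrite /apply_acts /heads /restrict /upd !ffunE -val_eqE /= inordK //.
  by case: eqP => [->|_] //=; case: (g j).
- move=> a b t1 t2 g1 g2 g3 _ IH1 _ IH2; rewrite geq_max => /andP[/IH1 h1 /IH2 h2].
  exact: goes_seql h1 h2.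
- move=> i p a g np; rewrite geq_max => /andP[le_in _].
  by rewrite /heads ffunE /restrict inordK // (negbTE np) /= -/(restrict g) apply_idle.
- move=> i p a t1 t2 g1 g2 g3 pg _ IH1 _ IH2; rewrite geq_max => /andP[le_in le_a].
  rewrite /heads ffunE /restrict inordK // pg /= -/(restrict g1) apply_idle.
  by apply: goes_while (IH1 le_a) (IH2 _); rewrite geq_max le_in.
Qed.

Definition machine_of (c : cmd) : machine :=
  @Machine n unit (option (cstate c)) (Some (cstart c)) (fun o => o == None)
    (fun o x => if o is Some s then ctrans s x else (None, idle x)).

Lemma goes_iter c t s g g' : goes t s g g' ->
  iter t (@step (machine_of c)) (Some s, g) = (None, g').
Proof.
elim: t s g => [s g []|t IH] s g h.
rewrite iterSr; move: h => /=.
rewrite /step /= -/(heads g).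
case: (ctrans s (heads g)) => [[s'|] x] /=; first by move=> /IH <-.
by move=> [-> <-].
Qed.

Lemma runs_to_machine_of c t T w g g' :
  exec c t g g' -> max_index c <= n -> t <= T ->
  (forall i, i <= n -> g i = word_tape unit (if i == 0 then w else [::])) ->
  runs_to (machine_of c) w T (tape_word (g' 0)).
Proof.
move=> ec le_cn le_tT g_init; rewrite /runs_to.
have -> : init (machine_of c) w = (Some (cstart c), restrict g).
  congr (_, _); apply/funext => i.
  by rewrite /restrict g_init -1?ltnS // -val_eqE.
rewrite -(subnK le_tT) iterD (goes_iter (exec_goes ec le_cn)).
have -> : iter (T - t) (@step (machine_of c)) (None, restrict g') = (None, restrict g').
  by elim: (T - t) => //= k ->.
by [].
Qed.

End Compilation.

(** * Registers *)

(* Register [r] lives on tape [r.+1]: its value is the distance of the head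
   from the marker. *)
Definition is_reg (v : nat) (t : ttape) : Prop := exists j,
  t = Tape (if v is v'.+1 then nseq v' None ++ [:: marker] else [::])
           (if v is 0 then marker else None) (nseq j None).

Definition store := (ttape * (nat -> nat))%type.

Definition represents (s : store) (g : nat -> ttape) : Prop :=
  g 0 = s.1 /\ forall r, is_reg (s.2 r) (g r.+1).

(** A store fixes the register tapes only up to trailing blanks left by earlier visits, hence the
    quantification over [g]. The time is an upper bound, so that costs can be rounded up. *)
Definition ex (c : cmd) (T : nat) (s s' : store) : Prop :=
  forall g, represents s g ->
  exists t g', [/\ t <= T, exec c t g g' & represents s' g'].

Definition Inc r := Act r.+1 (fun x => (x, MoveRight)).
(** The marker is the only nonblank cell of a register tape, so scanning [Some _] is the test for 0,
    where the predecessor is truncated. *)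
Definition Dec r :=
  Act r.+1 (fun x => (x, if x is Some _ then Stay else MoveLeft)).
Definition WhileReg r c :=
  While r.+1 (fun x => if x is Some _ then false else true) c.

Lemma ex_weaken c T T' s s' : ex c T s s' -> T <= T' -> ex c T' s s'.
Proof.
move=> h le g /h [t [g' [le_t e r]]]; exists t, g'; split=> //.
exact: leq_trans le.
Qed.

Lemma ex_seq a b Ta Tb s1 s2 s3 :
  ex a Ta s1 s2 -> ex b Tb s2 s3 -> ex (Seq a b) (Ta + Tb) s1 s3.
Proof.
move=> ha hb g /ha [t1 [g1 [le1 e1 /hb [t2 [g2 [le2 e2 r]]]]]].
exists (t1 + t2), g2; split=> //; first exact: leq_add.
exact: exec_seq e1 e2.
Qed.

Lemma ex_io f t rho : ex (Act 0 f) 1 (t, rho) (act f t, rho).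
Proof.
move=> g [g0 gr]; exists 1, (upd g 0 (act f (g 0))); split=> //.
  exact: exec_act.
by split=> [|r]; rewrite /upd //= g0.
Qed.

Lemma ex_reg r f v t rho :
  (forall x, is_reg (rho r) x -> is_reg v (act f x)) ->
  ex (Act r.+1 f) 1 (t, rho) (t, upd rho r v).
Proof.
move=> hf g [g0 gr]; exists 1, (upd g r.+1 (act f (g r.+1))); split=> //.
  exact: exec_act.
split=> [|q]; rewrite /upd //= eqSS; case: eqP => // _.
exact: hf (gr r).
Qed.

Lemma ex_inc r t rho : ex (Inc r) 1 (t, rho) (t, upd rho r (rho r).+1).
Proof.
apply: ex_reg => x [j ->]; exists j.-1; rewrite /act /Defs.shift /write /=.
by case: (rho r) => [|v]; case: j.
Qed.

Lemma ex_dec r t rho : ex (Dec r) 1 (t, rho) (t, upd rho r (rho r).-1).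
Proof.
apply: ex_reg => x [j ->]; rewrite /act /write /=.
case: (rho r) => [|[|v]] /=; [by exists j | by exists j.+1 | by exists j.+1].
Qed.

Lemma ex_while_stop i (p : pred tcell) c s :
  (forall g, represents s g -> ~~ p (scanned (g i))) ->
  ex (While i p c) 1 s s.
Proof. by move=> np g rg; exists 1, g; split=> //; apply/exec_stop/np. Qed.

Lemma ex_while_loop i (p : pred tcell) c T1 T2 s1 s2 s3 :
  (forall g, represents s1 g -> p (scanned (g i))) ->
  ex c T1 s1 s2 -> ex (While i p c) T2 s2 s3 ->
  ex (While i p c) (T1 + T2).+1 s1 s3.
Proof.
move=> pc h1 h2 g rg.
have [t1 [g1 [le1 e1 /h2 [t2 [g2 [le2 e2 r2]]]]]] := h1 g rg.
exists (t1 + t2).+1, g2; split=> //; first by rewrite ltnS leq_add.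
by apply: exec_loop e1 e2; apply: pc rg.
Qed.

Lemma ex_while i (p : pred tcell) c T n (s : nat -> store) :
  (forall k g, k < n -> represents (s k) g -> p (scanned (g i))) ->
  (forall g, represents (s n) g -> ~~ p (scanned (g i))) ->
  (forall k, k < n -> ex c T (s k) (s k.+1)) ->
  ex (While i p c) (n * T.+1).+1 (s 0) (s n).
Proof.
elim: n s => [|n IH] s hp hn hc; first exact: ex_while_stop.
apply: ex_weaken (_ : ex _ (T + (n * T.+1).+1).+1 _ _) _; last by lia.
apply: ex_while_loop (hc 0 isT) _; first by move=> g; apply: hp.
by apply: (IH (fun k => s k.+1)) => [k h lt||k lt]; [apply: hp | | apply: hc].
Qed.

Lemma ex_while_reg r c T n (s : nat -> store) :
  (forall k, k <= n -> (s k).2 r = n - k) ->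
  (forall k, k < n -> ex c T (s k) (s k.+1)) ->
  ex (WhileReg r c) (n * T.+1).+1 (s 0) (s n).
Proof.
move=> hr hc; apply: ex_while => [k g lt [_ /(_ r)]|g [_ /(_ r)]|//].
  rewrite hr 1?ltnW //; case: (n - k) (subn_gt0 k n); first by rewrite lt.
  by move=> m _ [j ->].
by rewrite hr // subnn => -[j ->].
Qed.

Lemma upd_id rho (r : nat) : upd rho r (rho r) = rho :> (nat -> nat).
Proof. by apply/funext => j; rewrite /upd; case: eqP => // ->. Qed.

Ltac upd_tac :=
  apply/funext => ?; rewrite /upd /=; repeat (case: eqP => ?; subst => //); lia.

Definition Clear r := WhileReg r (Dec r).

Lemma ex_clear r t rho :
  ex (Clear r) (rho r * 2).+1 (t, rho) (t, upd rho r 0).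
Proof.
have := @ex_while_reg r (Dec r) 1 (rho r) (fun k => (t, upd rho r (rho r - k))).
rewrite subn0 subnn upd_id; apply=> k /=; first by rewrite /upd eqxx.
move=> lt; have := @ex_dec r t (upd rho r (rho r - k)).
by congr ex; congr pair; rewrite /upd /= eqxx; upd_tac.
Qed.

Definition Move a b := WhileReg a (Seq (Dec a) (Inc b)).

Lemma ex_move a b t rho : a != b ->
  ex (Move a b) (rho a * 3).+1 (t, rho)
     (t, upd (upd rho a 0) b (rho a + rho b)).
Proof.
move=> /eqP neq.
have := @ex_while_reg a (Seq (Dec a) (Inc b)) 2 (rho a)
  (fun k => (t, upd (upd rho a (rho a - k)) b (k + rho b))).
rewrite subn0 subnn upd_id upd_id; apply=> k /=.
  by rewrite /upd eqxx; case: eqP.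
move=> lt; have := ex_seq (@ex_dec a t _) (@ex_inc b t _).
move=> /(_ (upd (upd rho a (rho a - k)) b (k + rho b))).
by congr ex; congr pair; rewrite /upd /= !eqxx; upd_tac.
Qed.

(** Counting [a] down destroys it; the scratch register [c] serves to restore it. *)
Definition Copy a b c := Seq (WhileReg a (Seq (Dec a) (Seq (Inc b) (Inc c)))) (Move c a).

Lemma ex_copy a b c t rho : a != b -> a != c -> b != c -> rho b = 0 -> rho c = 0 ->
  ex (Copy a b c) (rho a * 7 + 2) (t, rho) (t, upd rho b (rho a)).
Proof.
move=> /eqP ab /eqP ac /eqP bc b0 c0.
have h1 : ex (WhileReg a (Seq (Dec a) (Seq (Inc b) (Inc c)))) (rho a * 4).+1
  (t, rho) (t, upd (upd (upd rho a 0) b (rho a)) c (rho a)).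
  have := @ex_while_reg a (Seq (Dec a) (Seq (Inc b) (Inc c))) 3 (rho a)
    (fun k => (t, upd (upd (upd rho a (rho a - k)) b k) c k)).
  have -> : upd (upd (upd rho a (rho a - 0)) b 0) c 0 = rho by upd_tac.
  rewrite subnn; apply=> k /=.
    by rewrite /upd eqxx; do 2 case: eqP => //.
  move=> lt; have := ex_seq (@ex_dec a t _) (ex_seq (@ex_inc b t _) (@ex_inc c t _)).
  move=> /(_ (upd (upd (upd rho a (rho a - k)) b k) c k)).
  by congr ex; congr pair; rewrite /upd /= !eqxx; upd_tac.
have /eqP ca : c <> a by move=> e; apply: ac.
have h2 := @ex_move c a t (upd (upd (upd rho a 0) b (rho a)) c (rho a)) ca.
apply: ex_weaken (_ : ex _ ((rho a * 4).+1 + (rho a * 3).+1) _ _) _; last by lia.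
apply: ex_seq h1 _; move: h2; rewrite {1}/upd eqxx.
by congr ex; congr pair; upd_tac.
Qed.

(** * Arithmetic expressions *)

Inductive expr :=
| Var of nat
| Zero
| Succ of expr
| Pred of expr
| Rec of expr & expr & expr.

(* [Rec e0 e1 e2] starts with the value of [e0] and runs, for [i] from
   [e1 - 1] down to [0], the update [acc := e2], where [e2] sees [acc] as
   variable 0 and [i] as variable 1; [F i] is the value of [acc] after round
   [i].  All intermediate values are at most [B]. *)
Inductive evals (B : nat) : expr -> seq nat -> nat -> Prop :=
| val_var i l : i < size l -> nth 0 l i <= B -> evals B (Var i) l (nth 0 l i)
| val_zero l : evals B Zero l 0
| val_succ e l v : evals B e l v -> v < B -> evals B (Succ e) l v.+1
| val_pred e l v : evals B e l v -> evals B (Pred e) l v.-1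
| val_rec e0 e1 e2 l n (F : nat -> nat) :
    evals B e0 l (F n) -> evals B e1 l n ->
    (forall i, i < n -> evals B e2 (F i.+1 :: i :: l) (F i)) ->
    evals B (Rec e0 e1 e2) l (F 0).

Lemma val_le B e l v : evals B e l v -> v <= B.
Proof.
elim=> {e l v} // [e l v _ le|e0 e1 e2 l [|n] F _ h0 _ h1 _ h2]; first by lia.
  exact: h0.
exact: h2.
Qed.

Lemma val_mono B B' e l v : evals B e l v -> B <= B' -> evals B' e l v.
Proof.
move=> h le; elim: h => {e l v}.
- by move=> i l lt leB; apply: val_var => //; apply: leq_trans le.
- by move=> l; apply: val_zero.
- by move=> e l v _ h lt; apply: val_succ => //; apply: leq_trans le.
- by move=> e l v _ h; apply: val_pred.
- by move=> e0 e1 e2 l n F _ h0 _ h1 _ h2; apply: val_rec h0 h1 h2.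
Qed.

(** [pi] assigns registers to the variables and [m] is the first free register. Those from [m] on
    hold 0 before and after, except that [m] receives the value. In [Rec], [m] is the accumulator,
    [m.+1] the counter, and the body computes into [m.+2]. *)
Fixpoint compile (e : expr) (pi : seq nat) (m : nat) : cmd :=
  match e with
  | Var i => Copy (nth 0 pi i) m m.+1
  | Zero => Act 0 (fun x => (x, Stay))
  | Succ e => Seq (compile e pi m) (Inc m)
  | Pred e => Seq (compile e pi m) (Dec m)
  | Rec e0 e1 e2 => Seq (compile e0 pi m) (Seq (compile e1 pi m.+1)
      (WhileReg m.+1 (Seq (Dec m.+1)
        (Seq (compile e2 [:: m, m.+1 & pi] m.+2) (Seq (Clear m) (Move m.+2 m))))))
  end.

Fixpoint time_exp (e : expr) : nat :=
  match e with
  | Var _ => 2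
  | Zero => 1
  | Succ e | Pred e => (time_exp e).+1
  | Rec e0 e1 e2 => time_exp e0 + time_exp e1 + time_exp e2 + 3
  end.

Lemma time_exp_gt0 e : 0 < time_exp e.
Proof. by case: e => //= *; rewrite addn3. Qed.

(** A loop has at most [B] rounds, and clearing or moving a register costs [O(B)], so the time stays
    a power of [B]; [16 <= B] absorbs the additive constants. *)
Lemma compile_correct B e l v : 16 <= B -> evals B e l v ->
  forall pi m rho t, l = map rho pi -> all (fun r => r < m) pi ->
  (forall r, m <= r -> rho r = 0) ->
  ex (compile e pi m) (B ^ time_exp e) (t, rho) (t, upd rho m v).
Proof.
move=> B16; have B0 : 0 < B by lia.
have step_time e' : (B ^ time_exp e').+1 <= B ^ (time_exp e').+1.
  by rewrite expnS; have := expn_gt0 B (time_exp e'); rewrite B0; nia.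
elim=> {e l v}.
- move=> i l lt le pi m rho t el /allP pi_lt z /=.
  rewrite {}el size_map in lt le *.
  rewrite (nth_map 0) // in le *; have ltm := pi_lt _ (mem_nth 0 lt).
  move: (nth 0 pi i) ltm le => r ltm le.
  apply: ex_weaken (@ex_copy _ _ _ t rho _ _ _ (z m _) (z m.+1 _)) _; try by lia.
  by rewrite (_ : B ^ 2 = B * B) ?mulnn //; nia.
- move=> l pi m rho t _ _ z /=.
  have -> : upd rho m 0 = rho by rewrite -(z m (leqnn m)) upd_id.
  apply: ex_weaken (_ : ex _ 1 _ _) _; last by rewrite expn1.
  by have := @ex_io (fun x => (x, Stay)) t rho; case: t.
- move=> e l v _ IH lt pi m rho t el api z /=.
  apply: ex_weaken (step_time e); rewrite -addn1.
  apply: ex_seq (IH pi m rho t el api z) _.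
  have := @ex_inc m t (upd rho m v).
  by congr ex; congr pair; upd_tac.
- move=> e l v _ IH pi m rho t el api z /=.
  apply: ex_weaken (step_time e); rewrite -addn1.
  apply: ex_seq (IH pi m rho t el api z) _.
  have := @ex_dec m t (upd rho m v).
  by congr ex; congr pair; upd_tac.
move=> e0 e1 e2 l n F v0 IH0 v1 IH1 v2 IH2 pi m rho t el api z /=.
have leF i : i <= n -> F i <= B.
  by rewrite leq_eqVlt => /orP[/eqP->|/v2/val_le//]; apply: val_le v0.
have len := val_le v1.
pose s k : store := (t, upd (upd rho m (F (n - k))) m.+1 (n - k)).
have h0 := IH0 pi m rho t el api z.
have h1 : ex (compile e1 pi m.+1) (B ^ time_exp e1) (t, upd rho m (F n)) (s 0).
  rewrite /s subn0; apply: IH1.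
  - rewrite el; apply/eq_in_map => r /(allP api) lt.
    by rewrite /upd; case: eqP => // ?; lia.
  - by apply/allP => r /(allP api); lia.
  - by move=> r lt; rewrite /upd; case: eqP => [?|_]; [lia | apply: z; lia].
pose body := Seq (Dec m.+1) (Seq (compile e2 [:: m, m.+1 & pi] m.+2)
  (Seq (Clear m) (Move m.+2 m))).
have hb k : k < n -> ex body (B ^ time_exp e2 + (5 * B + 3)) (s k) (s k.+1).
  move=> lt.
  pose r1 := upd (upd rho m (F (n - k))) m.+1 (n - k.+1).
  have b1 : ex (Dec m.+1) 1 (s k) (t, r1).
    have := @ex_dec m.+1 t (s k).2; congr ex; congr pair; rewrite /r1 /s; upd_tac.
  pose r2 := upd r1 m.+2 (F (n - k.+1)).
  have b2 : ex (compile e2 [:: m, m.+1 & pi] m.+2) (B ^ time_exp e2) (t, r1) (t, r2).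
    apply: (IH2 (n - k.+1)); first by lia.
    - rewrite /= -subSn // subSS /r1 /upd /= !eqxx; case: eqP => [?|_]; first by lia.
      congr [:: _, _ & _]; rewrite el; apply/eq_in_map => r /(allP api) ltr.
      by case: eqP => [?|_]; [lia | case: eqP => // ?; lia].
    - by rewrite /= ltnS leqnSn ltnSn; apply/allP => r /(allP api); lia.
    - move=> r ltr; rewrite /r1 /upd; case: eqP => [?|_]; first by lia.
      by case: eqP => [?|_]; [lia | apply: z; lia].
  have b3 := @ex_clear m t r2.
  have b4 : ex (Move m.+2 m) (F (n - k.+1) * 3).+1 (t, upd r2 m 0) (s k.+1).
    have neq : m.+2 != m by lia.
    have q1 : upd r2 m 0 m.+2 = F (n - k.+1).
      by rewrite /r2 /upd (negbTE neq) eqxx.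
    have q2 : upd r2 m 0 m = 0 by rewrite /upd eqxx.
    have := @ex_move m.+2 m t (upd r2 m 0) neq; rewrite q1 q2 addn0.
    have z2 : rho m.+2 = 0 by apply: z; lia.
    rewrite /s; congr ex; congr pair; rewrite /r2 /r1; upd_tac.
  apply: ex_weaken (ex_seq b1 (ex_seq b2 (ex_seq b3 b4))) _.
  have -> : r2 m = F (n - k).
    by rewrite /r2 /r1 /upd; do 2 (case: eqP => [?|_]; first by lia); rewrite eqxx.
  have := leF (n - k) (leq_subr _ _); have := leF (n - k.+1) (leq_subr _ _).
  by lia.
have h2 : ex (WhileReg m.+1 body) (n * (B ^ time_exp e2 + (5 * B + 3)).+1).+1 (s 0) (s n).
  apply: ex_while_reg => k; last exact: hb.
  by rewrite /= /upd eqxx.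
have -> : upd rho m (F 0) = (s n).2.
  have z1 : rho m.+1 = 0 by apply: z; lia.
  by rewrite /s subnn /=; upd_tac.
apply: ex_weaken (ex_seq h0 (ex_seq h1 h2)) _.
set S := time_exp e0 + time_exp e1 + time_exp e2.
have S3 : 1 < S.
  by have := time_exp_gt0 e0; have := time_exp_gt0 e1; have := time_exp_gt0 e2; lia.
have le0 : B ^ time_exp e0 <= B ^ S by rewrite leq_exp2l; lia.
have le1 : B ^ time_exp e1 <= B ^ S by rewrite leq_exp2l; lia.
have le2 : B ^ time_exp e2 <= B ^ S by rewrite leq_exp2l; lia.
have le3 : B ^ 2 <= B ^ S by rewrite leq_exp2l; lia.
rewrite (addn3 S) !expnS.
have : n * (B ^ time_exp e2 + (5 * B + 3)).+1 <= B * (2 * B ^ S).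
  by rewrite leq_mul //; nia.
by move: (B ^ S) le0 le1 le2 le3 => X *; nia.
Qed.

(** * Addition, parity, halving and bits as expressions *)

Definition AddE a b := Rec a b (Succ (Var 0)).
Definition IsZeroE a := Rec (Succ Zero) a Zero.
Definition OddE a := Rec Zero a (IsZeroE (Var 0)).
(** Half of [a], rounded down, is the number of odd integers below [a]. *)
Definition HalfE a := Rec Zero a (AddE (Var 0) (OddE (Var 1))).
Definition BitE := OddE (Rec (Var 0) (Var 1) (HalfE (Var 0))).

Section Values.
Variable B : nat.
Hypothesis B0 : 0 < B.
Implicit Types (a b e : expr) (l : seq nat) (i n x y : nat).

Lemma val_nth i l v : i < size l -> nth 0 l i = v -> v <= B -> evals B (Var i) l v.
Proof. by move=> lt <-; apply: val_var. Qed.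

Lemma val_rec_to e0 e1 e2 l n (F : nat -> nat) v :
  evals B e0 l (F n) -> evals B e1 l n ->
  (forall i, i < n -> evals B e2 (F i.+1 :: i :: l) (F i)) ->
  F 0 = v -> evals B (Rec e0 e1 e2) l v.
Proof. by move=> h0 h1 h2 <-; apply: val_rec h0 h1 h2. Qed.

Lemma val_eq e l v v' : evals B e l v -> v = v' -> evals B e l v'.
Proof. by move=> h <-. Qed.

Lemma val_add a b l x y : evals B a l x -> evals B b l y -> x + y <= B ->
  evals B (AddE a b) l (x + y).
Proof.
move=> ha hb le; apply: (@val_rec_to _ _ _ _ y (fun i => x + (y - i))) => //.
- by rewrite subnn addn0.
- move=> i lt; apply: (@val_eq _ _ (x + (y - i.+1)).+1); last by lia.
  by apply: val_succ; [apply: val_nth => //=; lia | lia].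
- by rewrite subn0.
Qed.

Lemma val_is_zero a l x : evals B a l x -> evals B (IsZeroE a) l (x == 0).
Proof.
move=> h; apply: (@val_rec_to _ _ _ _ x (fun i => i == x)) => //.
- by rewrite eqxx; apply: val_succ B0; apply: val_zero.
- by move=> i lt; rewrite (ltn_eqF lt); apply: val_zero.
- by rewrite eq_sym.
Qed.

Lemma val_odd a l x : evals B a l x -> evals B (OddE a) l (odd x).
Proof.
move=> h; apply: (@val_rec_to _ _ _ _ x (fun i => odd (x - i))) => //.
- by rewrite subnn; apply: val_zero.
- move=> i lt; apply: (@val_eq _ _ (odd (x - i.+1) == 0 :> nat)).
    by apply: val_is_zero; apply: val_nth => //=; case: odd.
  have -> : x - i = (x - i.+1).+1 by lia.
  by rewrite oddS; case: odd.
- by rewrite subn0.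
Qed.

Lemma val_half a l x : evals B a l x -> evals B (HalfE a) l x./2.
Proof.
move=> h; have le := val_le h.
apply: (@val_rec_to _ _ _ _ x (fun i => x./2 - i./2)) => //.
- by rewrite subnn; apply: val_zero.
- move=> i lt; have leB j : x./2 - j <= B by lia.
  apply: (@val_eq _ _ ((x./2 - i.+1./2) + odd i)); last by lia.
  apply: val_add; first exact: val_nth.
    by apply: val_odd; apply: val_nth => //=; lia.
  by lia.
- by rewrite subn0.
Qed.

Lemma val_bit l x i : 1 < size l -> nth 0 l 0 = x -> nth 0 l 1 = i ->
  x <= B -> i <= B -> evals B BitE l (odd (x %/ 2 ^ i)).
Proof.
move=> sz ex ei le lei.
have iterE j : iter j half x = x %/ 2 ^ j.
  elim: j => [|j IH]; first by rewrite divn1.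
  by rewrite iterS IH -divn2 -divnMA expnSr.
apply: val_odd.
apply: (@val_rec_to _ _ _ _ i (fun j => x %/ 2 ^ (i - j))) => //.
- by rewrite subnn divn1; apply: val_nth => //; lia.
- by apply: val_nth.
- move=> j lt; apply: (@val_eq _ _ (x %/ 2 ^ (i - j.+1))./2).
    by apply: val_half; apply: val_nth => //=; apply: leq_trans (leq_div _ _) le.
  by rewrite -divn2 -divnMA -expnSr; congr (_ %/ 2 ^ _); lia.
- by rewrite subn0.
Qed.

End Values.

Lemma bits_val_mkseq n k : n < 2 ^ k ->
  bits_val (mkseq (fun i => odd (n %/ 2 ^ i)) k) = n.
Proof.
elim: k n => [|k IH] n lt; first by case: n lt.
rewrite /mkseq /= (iotaDl 1 0) -map_comp.
rewrite divn1 (eq_map (g := fun i => odd (n./2 %/ 2 ^ i))); last first.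
  by move=> i /=; rewrite add1n expnS divnMA divn2.
rewrite IH; first by lia.
by move: lt; rewrite expnS; lia.
Qed.

(** Bounds the last weight met when a numeral is read, which is held in a unary register. *)
Lemma size_bits n : 2 ^ size (bits n) <= 2 * n.+1.
Proof.
rewrite size_mkseq; case: n => [|n] //.
have /andP[] := @up_log_bounds 2 n.+2 isT isT.
have := @up_log_gt0 2 n.+2; rewrite /=; case: (up_log 2 n.+2) => [//|k] _ /= lt _.
by rewrite expnS leq_mul2l /=; apply: ltnW.
Qed.

Lemma bits_valK n : bits_val (bits n) = n.
Proof.
apply: bits_val_mkseq; case: n => [|n] //.
by have /andP[] := @up_log_bounds 2 n.+2 isT isT.
Qed.

(** * Input and output *)

Definition scan_tape (L s : seq tcell) : ttape := Tape L (head None s) (behead s).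

Definition sym (x : symbol) : tcell := Some (inl x).

Definition IOMove m := Act 0 (fun x => (x, m)).
Definition IOWrite x := Act 0 (fun _ => (sym x, Stay)).

Lemma ex_io_right L x s rho :
  ex (IOMove MoveRight) 1 (scan_tape L (x :: s), rho) (scan_tape (x :: L) s, rho).
Proof. exact: ex_io. Qed.

Lemma ex_io_write L x y s rho :
  ex (IOWrite x) 1 (scan_tape L (y :: s), rho) (scan_tape L (sym x :: s), rho).
Proof. exact: ex_io. Qed.

Definition Out x := Seq (IOMove MoveLeft) (IOWrite x).

Lemma ex_out L x y s rho :
  ex (Out x) 2 (scan_tape L (y :: s), rho)
     (scan_tape (behead L) [:: sym x, y & s], rho).
Proof.
apply: (@ex_seq _ _ 1 1 _ (scan_tape (behead L) (head None L :: y :: s), rho)).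
  exact: ex_io.
exact: ex_io_write.
Qed.

(** With [c] equal to [q], the scratch register grows by 2 in each round, and the same command
    doubles [p]. *)
Definition AddDouble p q c :=
  Seq (WhileReg p (Seq (Dec p) (Seq (Inc q) (Inc c)))) (Move q p).

Definition is_one (c : tcell) := if c is Some (inl (Some true)) then true else false.
Definition is_bit (c : tcell) := if c is Some (inl (Some _)) then true else false.

(* Register [r] is the value read so far, [r.+1] the weight of the next bit. *)
Definition ReadBit r :=
  Seq (While 0 is_one (Seq (AddDouble r.+1 r.+2 r) (IOWrite (Some false))))
      (Seq (AddDouble r.+1 r.+2 r.+2) (IOMove MoveRight)).

Definition ReadNum r :=
  Seq (Inc r.+1) (Seq (While 0 is_bit (ReadBit r))
    (Seq (IOMove MoveRight) (Clear r.+1))).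

Ltac reg_tac := repeat (case: eqP => ? //); lia.

Definition reg3 (rho : nat -> nat) r x y z :=
  upd (upd (upd rho r x) r.+1 y) r.+2 z.

Lemma ex_add_weight rho t r v w :
  ex (AddDouble r.+1 r.+2 r) (w * 7 + 2) (t, reg3 rho r v w 0)
     (t, reg3 rho r (v + w) w 0).
Proof.
apply: ex_weaken (_ : ex _ ((w * 4).+1 + (w * 3).+1) _ _) _; last by lia.
apply: (@ex_seq _ _ _ _ _ (t, reg3 rho r (v + w) 0 w)).
  have := @ex_while_reg r.+1 (Seq (Dec r.+1) (Seq (Inc r.+2) (Inc r))) 3 w
    (fun k => (t, reg3 rho r (v + k) (w - k) k)).
  rewrite subnn subn0 addn0; apply=> k /=.
    by rewrite /reg3 /upd; reg_tac.
  move=> lt; set rk := reg3 _ _ _ _ _.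
  have := ex_seq (@ex_dec r.+1 t rk) (ex_seq (@ex_inc r.+2 t _) (@ex_inc r t _)).
  by congr ex; congr pair; rewrite /rk /reg3; upd_tac.
have neq : r.+2 != r.+1 by lia.
have := @ex_move r.+2 r.+1 t (reg3 rho r (v + w) 0 w) neq.
have -> : reg3 rho r (v + w) 0 w r.+2 = w by rewrite /reg3 /upd eqxx.
have -> : reg3 rho r (v + w) 0 w r.+1 = 0 by rewrite /reg3 /upd; reg_tac.
by congr ex; congr pair; rewrite /reg3; upd_tac.
Qed.

Lemma ex_double_weight rho t r v w :
  ex (AddDouble r.+1 r.+2 r.+2) (w * 10 + 2) (t, reg3 rho r v w 0)
     (t, reg3 rho r v (2 * w) 0).
Proof.
apply: ex_weaken (_ : ex _ ((w * 4).+1 + (2 * w * 3).+1) _ _) _; last by lia.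
apply: (@ex_seq _ _ _ _ _ (t, reg3 rho r v 0 (2 * w))).
  have := @ex_while_reg r.+1 (Seq (Dec r.+1) (Seq (Inc r.+2) (Inc r.+2))) 3 w
    (fun k => (t, reg3 rho r v (w - k) (2 * k))).
  rewrite subnn subn0 muln0; apply=> k /=.
    by rewrite /reg3 /upd; reg_tac.
  move=> lt; set rk := reg3 _ _ _ _ _.
  have := ex_seq (@ex_dec r.+1 t rk) (ex_seq (@ex_inc r.+2 t _) (@ex_inc r.+2 t _)).
  by congr ex; congr pair; rewrite /rk /reg3; upd_tac.
have neq : r.+2 != r.+1 by lia.
have := @ex_move r.+2 r.+1 t (reg3 rho r v 0 (2 * w)) neq.
have -> : reg3 rho r v 0 (2 * w) r.+2 = 2 * w by rewrite /reg3 /upd eqxx.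
have -> : reg3 rho r v 0 (2 * w) r.+1 = 0 by rewrite /reg3 /upd; reg_tac.
by congr ex; congr pair; rewrite /reg3; upd_tac.
Qed.

(** The [While] acts as a conditional: overwriting the bit 1 by 0 ends it after one round. *)
Lemma ex_read_bit rho r L (b : bool) s v w : exists L',
  ex (ReadBit r) (w * 17 + 9) (scan_tape L (sym (Some b) :: s), reg3 rho r v w 0)
     (scan_tape L' s, reg3 rho r (v + w * b) (2 * w) 0).
Proof.
exists (sym (Some false) :: L).
apply: ex_weaken (_ : ex _ ((w * 7 + 2 + 1 + 1).+1 + (w * 10 + 2 + 1)) _ _) _; last by lia.
apply: (@ex_seq _ _ _ _ _ (scan_tape L (sym (Some false) :: s), reg3 rho r (v + w * b) w 0)); last first.
  apply: ex_seq; first exact: ex_double_weight.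
  exact: ex_io_right.
case: b.
  rewrite muln1; apply: ex_while_loop; first by move=> g [-> _].
    apply: ex_seq; first exact: ex_add_weight.
    exact: ex_io_write.
  by apply: ex_while_stop => g [-> _].
rewrite muln0 addn0; apply: ex_weaken (_ : ex _ 1 _ _) _; last by lia.
by apply: ex_while_stop => g [-> _].
Qed.

Lemma ex_read_bits rho r bs L s v w : exists L',
  ex (While 0 is_bit (ReadBit r)) (size bs * (w * 2 ^ size bs * 17 + 10)).+1
     (scan_tape L ([seq sym (Some b) | b <- bs] ++ sym None :: s), reg3 rho r v w 0)
     (scan_tape L' (sym None :: s),
      reg3 rho r (v + w * bits_val bs) (w * 2 ^ size bs) 0).
Proof.
elim: bs L v w => [|b bs IH] L v w.
  exists L; rewrite muln0 addn0 expn0 muln1.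
  by apply: ex_while_stop => g [-> _].
have [L1 h1] := ex_read_bit rho r L b ([seq sym (Some b) | b <- bs] ++ sym None :: s) v w.
have [L2 h2] := IH L1 (v + w * b) (2 * w).
exists L2; rewrite map_cons cat_cons.
have -> : v + w * bits_val (b :: bs) = v + w * b + 2 * w * bits_val bs.
  by rewrite /= -/(bits_val bs); lia.
have -> : w * 2 ^ size (b :: bs) = 2 * w * 2 ^ size bs by rewrite /= expnS; lia.
apply: ex_weaken (ex_while_loop _ h1 h2) _; first by move=> g [-> _].
have : 0 < 2 ^ size bs by rewrite expn_gt0.
by rewrite [size (_ :: _)]/=; move: (size bs) => n; set P := 2 ^ n; nia.
Qed.

Lemma ex_read_num B rho r n L s : 32 <= B -> 2 * n.+1 <= B ->
  (forall q, r <= q -> rho q = 0) -> exists L',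
  ex (ReadNum r) (B ^ 3)
     (scan_tape L ([seq sym (Some b) | b <- bits n] ++ sym None :: s), rho)
     (scan_tape L' s, upd rho r n).
Proof.
move=> B32 leB z.
have [L' h] := ex_read_bits rho r (bits n) L s 0 1.
exists (sym None :: L').
have le := leq_trans (size_bits n) leB.
have lt := ltn_expl (size (bits n)) (isT : 1 < 2).
move: h le lt; rewrite bits_valK !add0n !mul1n.
set P := 2 ^ _; set k := size _ => h le lt.
have [z0 z1 z2] : [/\ rho r = 0, rho r.+1 = 0 & rho r.+2 = 0].
  by split; apply: z; lia.
have hP : reg3 rho r n P 0 r.+1 = P.
  by rewrite /reg3 /upd; reg_tac.
apply: ex_weaken (_ : ex _ (1 + ((k * (P * 17 + 10)).+1 + (1 + (P * 2).+1))) _ _) _.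
  apply: (@ex_seq _ _ _ _ _ (_, reg3 rho r 0 1 0)).
    have := @ex_inc r.+1
      (scan_tape L ([seq sym (Some b) | b <- bits n] ++ sym None :: s)) rho.
        congr ex; congr pair; rewrite /reg3; upd_tac.
  apply: ex_seq h _; apply: ex_seq; first exact: ex_io_right.
  have := @ex_clear r.+1 (scan_tape (sym None :: L') s) (reg3 rho r n P 0).
  rewrite hP.
  by congr ex; congr pair; rewrite /reg3; upd_tac.
by rewrite !expnS expn0 muln1; nia.
Qed.

(** In [program], registers 0 to 3 hold the input, 4 and 5 the exponent of the denominator and the
    numerator, 6 the index of the next bit and 7 that bit. *)
Definition OutBit := Seq (compile BitE [:: 5; 6] 7)
  (Seq (Out (Some false)) (WhileReg 7 (Seq (Dec 7) (IOWrite (Some true))))).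

(* The words are written from right to left: 2^m as 0...01, then the separator,
   then the numerator. *)
Definition program (Em Ea : expr) :=
  Seq (ReadNum 0) (Seq (ReadNum 1) (Seq (ReadNum 2) (Seq (ReadNum 3)
    (Seq (compile Em [:: 0; 1; 2; 3] 4) (Seq (compile Ea [:: 0; 1; 2; 3] 5)
    (Seq (Out (Some true)) (Seq (WhileReg 4 (Seq (Dec 4) (Out (Some false))))
    (Seq (Out None) (Seq (Copy 5 6 7)
      (WhileReg 6 (Seq (Dec 6) OutBit))))))))))).

Ltac nth_tac := apply/funext; do 9?[case=> //=].

(** Register contents are written [nth 0 l], so that a result in the first free register is appended
    to the list. *)
Lemma nth_rcons_upd (l : seq nat) v : upd (nth 0 l) (size l) v = nth 0 (rcons l v).
Proof.
apply/funext => j; rewrite /upd nth_rcons.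
by case: ltngtP => // lt; rewrite nth_default // ltnW.
Qed.

Definition bit_cells (bs : seq bool) : seq tcell := [seq sym (Some b) | b <- bs].

Definition input_cells (ns : seq nat) : seq tcell :=
  flatten [seq rcons (bit_cells (bits n)) (sym None) | n <- ns].

Lemma ex_read_next B l n ns L : 32 <= B -> 2 * n.+1 <= B -> exists L',
  ex (ReadNum (size l)) (B ^ 3) (scan_tape L (input_cells (n :: ns)), nth 0 l)
     (scan_tape L' (input_cells ns), nth 0 (rcons l n)).
Proof.
move=> B32 le.
have z q : size l <= q -> nth 0 l q = 0 by apply: nth_default.
have [L' h] := ex_read_num L (input_cells ns) B32 le z.
by exists L'; rewrite -nth_rcons_upd /input_cells /= cat_rcons.
Qed.

Lemma ex_comp_last B e l v t : 16 <= B -> evals B e l v ->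
  forall l', ex (compile e (iota 0 (size l)) (size (l ++ l'))) (B ^ time_exp e)
    (t, nth 0 (l ++ l')) (t, nth 0 (rcons (l ++ l') v)).
Proof.
move=> B16 h l'; rewrite -nth_rcons_upd; apply: compile_correct B16 h _ _ _ _ _ _ _.
- apply: (@eq_from_nth _ 0); first by rewrite size_map size_iota.
  move=> i lt; rewrite (nth_map 0) ?size_iota // nth_iota // add0n nth_cat lt //.
- by apply/allP => r; rewrite mem_iota size_cat; lia.
- by move=> r; apply: nth_default.
Qed.

Lemma ex_out_bit B (l : seq nat) a i L y s : 16 <= B -> size l = 5 ->
  a <= B -> i <= B -> exists L',
  ex OutBit (B ^ time_exp BitE + 7)
     (scan_tape L (y :: s), nth 0 (l ++ [:: a; i]))
     (scan_tape L' [:: sym (Some (odd (a %/ 2 ^ i))), y & s],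
      nth 0 (l ++ [:: a; i])).
Proof.
move=> B16 sz lea lei; exists (behead L).
case: l sz => [|l0 [|l1 [|l2 [|l3 [|l4 []]]]]] // _ /=.
set b := odd _.
apply: (@ex_seq _ _ _ 7 _ (scan_tape L (y :: s),
          nth 0 [:: l0; l1; l2; l3; l4; a; i; nat_of_bool b])).
  have -> : nth 0 [:: l0; l1; l2; l3; l4; a; i; nat_of_bool b] =
            upd (nth 0 [:: l0; l1; l2; l3; l4; a; i]) 7 b by nth_tac.
  apply: (@compile_correct B _ [:: a; i]) => //.
    by apply: val_bit => //; lia.
  by move=> r lt; rewrite nth_default.
apply: (@ex_seq _ _ 2 5); first exact: ex_out.
have stop t : ex (WhileReg 7 (Seq (Dec 7) (IOWrite (Some true)))) 1
    (t, nth 0 [:: l0; l1; l2; l3; l4; a; i; 0])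
    (t, nth 0 [:: l0; l1; l2; l3; l4; a; i]).
  have -> : nth 0 [:: l0; l1; l2; l3; l4; a; i; 0] =
            nth 0 [:: l0; l1; l2; l3; l4; a; i] by nth_tac.
  by apply: ex_while_stop => g [_ /(_ 7) [j ->]].
case: b; last exact: ex_weaken (stop _) _.
apply: ex_weaken (ex_while_loop _ _ (stop _)) (_ : (2 + 1).+1 <= _) => //.
  by move=> g [_ /(_ 7) [j ->]].
apply: (@ex_seq _ _ 1 1 _ (scan_tape (behead L) [:: sym (Some false), y & s],
  nth 0 [:: l0; l1; l2; l3; l4; a; i; 0])); last exact: ex_io_write.
have := @ex_dec 7 (scan_tape (behead L) [:: sym (Some false), y & s])
  (nth 0 [:: l0; l1; l2; l3; l4; a; i; 1]).
by congr ex; congr pair; nth_tac.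
Qed.

Lemma ex_out_zeros (l : seq nat) m a L y s : size l = 4 -> exists L',
  ex (WhileReg 4 (Seq (Dec 4) (Out (Some false)))) (m * 4).+1
     (scan_tape L (y :: s), nth 0 (l ++ [:: m; a]))
     (scan_tape L' (bit_cells (nseq m false) ++ y :: s), nth 0 (l ++ [:: 0; a])).
Proof.
move=> sz; exists (iter m behead L).
have := @ex_while_reg 4 (Seq (Dec 4) (Out (Some false))) 3 m
  (fun k => (scan_tape (iter k behead L) (bit_cells (nseq k false) ++ y :: s),
             nth 0 (l ++ [:: m - k; a]))).
rewrite subn0 subnn; apply=> k /=; first by rewrite nth_cat sz.
move=> lt; apply: (@ex_seq _ _ 1 2 _
  (scan_tape (iter k behead L) (bit_cells (nseq k false) ++ y :: s),
             nth 0 (l ++ [:: m - k.+1; a]))).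
  set t := scan_tape _ _; have := @ex_dec 4 t (nth 0 (l ++ [:: m - k; a])).
  congr ex; congr pair; rewrite nth_cat sz /=.
  by case: l sz => [|l0 [|l1 [|l2 [|l3 []]]]] // _ /=; rewrite subnS; nth_tac.
by case: k lt => [|k] lt; apply: ex_out.
Qed.

Lemma ex_out_bits B (l : seq nat) a L y s : 16 <= B -> size l = 5 -> a <= B ->
  exists L' rho',
  ex (WhileReg 6 (Seq (Dec 6) OutBit)) (a * (B ^ time_exp BitE + 9)).+1
     (scan_tape L (y :: s), nth 0 (l ++ [:: a; a]))
     (scan_tape L' (bit_cells (mkseq (fun i => odd (a %/ 2 ^ i)) a) ++ y :: s), rho').
Proof.
move=> B16 sz lea.
pose bs k := [seq odd (a %/ 2 ^ i) | i <- iota (a - k) k].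
suff loop k : k <= a -> forall L y s, exists L' rho',
  ex (WhileReg 6 (Seq (Dec 6) OutBit)) (k * (B ^ time_exp BitE + 9)).+1
     (scan_tape L (y :: s), nth 0 (l ++ [:: a; k]))
     (scan_tape L' ([seq sym (Some (odd (a %/ 2 ^ i))) | i <- iota 0 k] ++ y :: s), rho').
  have [L' [rho' h]] := loop a (leqnn a) L y s.
  by exists L', rho'; rewrite /bit_cells /mkseq -map_comp.
elim: k => [|k IH] le {}L {}y {}s.
  exists L, (nth 0 (l ++ [:: a; 0])).
  by apply: ex_while_stop => g [_ /(_ 6)] /=; rewrite nth_cat sz => -[j ->].
have [L1 h1] := @ex_out_bit B l a k L y s B16 sz lea (leq_trans (ltnW le) lea).
have [L2 [rho2 h2]] := IH (ltnW le) L1 (sym (Some (odd (a %/ 2 ^ k)))) (y :: s).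
exists L2, rho2.
have -> : iota 0 k.+1 = rcons (iota 0 k) k by rewrite -addn1 iotaD cats1.
rewrite map_rcons cat_rcons.
apply: ex_weaken (ex_while_loop _ _ h2) (_ : (1 + (B ^ time_exp BitE + 7) + _).+1 <= _).
- by move=> g [_ /(_ 6)] /=; rewrite nth_cat sz => -[j ->].
- apply: ex_seq h1.
  have := @ex_dec 6 (scan_tape L (y :: s)) (nth 0 (l ++ [:: a; k.+1])).
  congr ex; congr pair; rewrite nth_cat sz /=.
  by case: l sz {IH h2} => [|l0 [|l1 [|l2 [|l3 [|l4 []]]]]] // _ /=; nth_tac.
by rewrite mulSn; lia.
Qed.

(** The numerator is written with [a] digits, with leading zeros: as [a < 2 ^ a], the value itself
    can serve as the length, and no logarithm has to be computed. *)
Definition output_cells m a : seq tcell :=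
  bit_cells (mkseq (fun i => odd (a %/ 2 ^ i)) a) ++
  sym None :: bit_cells (rcons (nseq m false) true).

Lemma ex_program Em Ea B n0 n1 n2 n3 m a : 32 <= B ->
  all (fun n => 2 * n.+1 <= B) [:: n0; n1; n2; n3] ->
  evals B Em [:: n0; n1; n2; n3] m -> evals B Ea [:: n0; n1; n2; n3] a ->
  exists L rho,
  ex (program Em Ea) (B ^ (time_exp Em + time_exp Ea + time_exp BitE + 10))
     (scan_tape [::] (input_cells [:: n0; n1; n2; n3]), fun _ => 0)
     (scan_tape L (output_cells m a ++ [:: None]), rho).
Proof.
move=> B32 /and5P[le0 le1 le2 le3 _] hm ha; have B16 : 16 <= B by lia.
have -> : (fun _ => 0) = nth 0 [::] by apply/funext => -[].
have [L1 r1] := @ex_read_next B [::] n0 [:: n1; n2; n3] [::] B32 le0.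
have [L2 r2] := @ex_read_next B [:: n0] n1 [:: n2; n3] L1 B32 le1.
have [L3 r3] := @ex_read_next B [:: n0; n1] n2 [:: n3] L2 B32 le2.
have [L4 r4] := @ex_read_next B [:: n0; n1; n2] n3 [::] L3 B32 le3.
have c1 := @ex_comp_last _ _ _ _ (scan_tape L4 (input_cells [::])) B16 hm [::].
have c2 := @ex_comp_last _ _ _ _ (scan_tape L4 (input_cells [::])) B16 ha [:: m].
have o1 := @ex_out L4 (Some true) None [::] (nth 0 [:: n0; n1; n2; n3; m; a]).
have [L5 o2] := @ex_out_zeros [:: n0; n1; n2; n3] m a (behead L4) (sym (Some true)) [:: None] erefl.
have [y [s es]] : exists y s,
    bit_cells (nseq m false) ++ [:: sym (Some true); None] = y :: s.
  by case: (m) => [|m'] /=; do 2 eexists.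
rewrite es in o2.
have o3 := @ex_out L5 None y s (nth 0 [:: n0; n1; n2; n3; 0; a]).
have o4 := @ex_copy 5 6 7 (scan_tape (behead L5) [:: sym None, y & s])
  (nth 0 [:: n0; n1; n2; n3; 0; a]) isT isT isT erefl erefl.
have [L6 [rho o5]] := @ex_out_bits B [:: n0; n1; n2; n3; 0] a (behead L5) (sym None) (y :: s)
  B16 erefl (val_le ha).
exists L6, rho.
have e4 : upd (nth 0 [:: n0; n1; n2; n3; 0; a]) 6 (nth 0 [:: n0; n1; n2; n3; 0; a] 5) =
          nth 0 ([:: n0; n1; n2; n3; 0] ++ [:: a; a]) by nth_tac.
rewrite e4 in o4.
have -> : output_cells m a ++ [:: None] =
    bit_cells (mkseq (fun i => odd (a %/ 2 ^ i)) a) ++ [:: sym None, y & s].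
  by rewrite /output_cells -catA cat_cons -es /bit_cells map_rcons cat_rcons.
apply: ex_weaken (ex_seq r1 (ex_seq r2 (ex_seq r3 (ex_seq r4 (ex_seq c1 (ex_seq c2
  (ex_seq o1 (ex_seq o2 (ex_seq o3 (ex_seq o4 o5)))))))))) _.
have lem := val_le hm; have lea := val_le ha; rewrite [nth 0 _ 5]/=.
set k1 := time_exp Em; set k2 := time_exp Ea; set k3 := time_exp BitE.
have p1 : B ^ k1 <= B ^ (k1 + k2 + k3) by rewrite leq_exp2l; lia.
have p2 : B ^ k2 <= B ^ (k1 + k2 + k3) by rewrite leq_exp2l; lia.
have p3 : B ^ k3 <= B ^ (k1 + k2 + k3) by rewrite leq_exp2l; lia.
have p0 : 0 < B ^ (k1 + k2 + k3) by rewrite expn_gt0; lia.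
have h5 : a * (B ^ k3 + 9) <= B * (10 * B ^ (k1 + k2 + k3)).
  by rewrite leq_mul //; lia.
rewrite expnD; set S := B ^ (k1 + k2 + k3) in p0 p1 p2 p3 h5 *.
have B3 : B * 32 <= B ^ 3 by rewrite !expnS expn0 muln1; nia.
have B10 : B ^ 3 * 32 <= B ^ 10.
  by rewrite (expnD B 3 7) leq_mul2l (leq_trans B32) ?orbT // -{1}(expn1 B) leq_exp2l; lia.
apply: leq_trans (_ : S * (B ^ 3 * 32) <= _); last by rewrite leq_mul2l B10 orbT.
have hX : B ^ 3 <= S * B ^ 3 by rewrite leq_pmull.
have hS : S <= S * B ^ 3 by rewrite leq_pmulr // expn_gt0; lia.
have hBS : S * (B * 32) <= S * B ^ 3 by rewrite leq_mul2l B3 orbT.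
move: (B ^ 3) B3 hX hS hBS h5 {B10} => X B3 hX hS hBS h5.
rewrite (mulnCA B) in h5; rewrite mulnA (mulnC S B) in hBS; rewrite mulnA.
by move: (S * X) (B * S) hX hS hBS h5 => Y Z hX hS hBS h5; lia.
Qed.

(** * Initial markers and doubly exponential time bounds *)

Fixpoint init_regs n :=
  if n is m.+1 then Seq (init_regs m) (Act m.+1 (fun _ => (marker, Stay)))
  else IOMove Stay.

Lemma max_index_init_regs n : max_index (init_regs n) = n.
Proof. by elim: n => //= n ->; apply/maxn_idPr. Qed.

Lemma exec_init_regs n g : exists g', [/\ exec (init_regs n) n.+1 g g',
  g' 0 = g 0 & forall r, g' r.+1 = if r < n then write marker (g r.+1) else g r.+1].
Proof.
elim: n => [|n [g1 [e1 z1 h1]]].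
  exists (upd g 0 (act (fun x => (x, Stay)) (g 0))); split=> //; first exact: exec_act.
  by rewrite /upd /=; case: (g 0).
exists (upd g1 n.+1 (write marker (g1 n.+1))); split=> //=.
  rewrite -(addn1 n.+1); apply: exec_seq e1 _; exact: exec_act.
move=> r; rewrite /upd eqSS h1 ltnS.
case: (ltngtP r n) => [lt|gt|e]; rewrite ?e ?h1 ?lt ?ltnn //.
by rewrite ltnNge (ltnW gt).
Qed.

Lemma word_prefix_cells (w : seq symbol) :
  word_prefix ([seq sym x | x <- w] ++ [:: None]) = w.
Proof. by elim: w => //= x w ->. Qed.

Lemma tape_word_cells L (w : seq symbol) :
  tape_word (scan_tape L ([seq sym x | x <- w] ++ [:: None])) = w.
Proof.
by case: w => [|x w] //; rewrite /tape_word /= word_prefix_cells.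
Qed.

Lemma bits_val_pow2 m : bits_val (rcons (nseq m false) true) = 2 ^ m.
Proof. by elim: m => //= m; rewrite -/(bits_val _) => ->; rewrite add0n -mul2n expnS. Qed.

Lemma double_exp_ge c X x : 0 < X -> x < 2 ^ X ->
  2 * x.+1 <= 2 ^ (2 ^ ((c + 7) * X)).
Proof.
move=> X0 lt; apply: leq_trans (_ : 2 ^ X.+1 <= _); first by rewrite expnS leq_mul2l.
rewrite leq_exp2l //; apply: (leq_trans (ltnW (ltn_expl X.+1 (isT : 1 < 2)))).
by rewrite leq_exp2l //; nia.
Qed.

Lemma double_exp_mono c X : 2 ^ (2 ^ (c * X)) <= 2 ^ (2 ^ ((c + 7) * X)).
Proof. by rewrite !leq_exp2l // leq_mul2r leq_addr orbT. Qed.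

Lemma double_exp_ge32 c X : 0 < X -> 32 <= 2 ^ (2 ^ ((c + 7) * X)).
Proof.
move=> X0; apply: leq_trans (_ : 2 ^ (2 ^ 3) <= _); first by [].
by rewrite !leq_exp2l //; nia.
Qed.

(** Bounds [2^(2^O(X))] are stable under polynomials: a power [k] multiplies the inner [2^((c+7)X)]
    by [k <= 2^(kX)]. *)
Lemma double_exp_time c X K n t : 0 < X -> t <= (2 ^ (2 ^ ((c + 7) * X))) ^ K ->
  n.+1 + t <= 2 ^ (2 ^ ((c + 7 + (K + n.+1)) * X)).
Proof.
move=> X0; have := double_exp_ge32 c X0.
set k := K + n.+1; set B := 2 ^ (2 ^ ((c + 7) * X)) => B32 let'.
apply: leq_trans (_ : B ^ k <= _).
  rewrite expnD; have Y0 : 0 < B ^ K by rewrite expn_gt0; lia.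
  have : n.+1 < B ^ n.+1 by apply: ltn_expl; lia.
  by move: (B ^ n.+1) (B ^ K) Y0 let' => Z Y; clear; nia.
rewrite -expnM leq_exp2l // [(c + 7 + k) * X]mulnDl expnD leq_mul2l.
apply/orP; right; apply: leq_trans (ltnW (ltn_expl k (isT : 1 < 2))) _.
by rewrite leq_exp2l // leq_pmulr.
Qed.

Theorem ee_time_computable_exprs (Em Ea : expr) (fm fa : nat -> nat -> nat * nat -> nat)
    (c : nat) :
  (forall s r u, Defs.J r u -> let B := 2 ^ (2 ^ (c * (s + r).+1)) in
     evals B Em [:: s; r; u.1; u.2] (fm s r u) /\
     evals B Ea [:: s; r; u.1; u.2] (fa s r u)) ->
  ee_time_computable (fun s r u => (fa s r u)%:R / (2 ^ fm s r u)%:R)%R.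
Proof.
move=> h.
(* Stated with a quantifier: [done] would try to evaluate an equation. *)
have [n hn] : exists n, forall x, x = max_index (program Em Ea) -> x <= n.
  by exists (max_index (program Em Ea)) => x ->.
pose k := time_exp Em + time_exp Ea + time_exp BitE + 10 + n.+1.
exists (machine_of n (Seq (init_regs n) (program Em Ea))), (c + 7 + k) => s r u Ju.
have := h s r u Ju.
have [X hX] : exists X, (s + r).+1 = X by eexists.
rewrite hX => -[hm ha].
have [B hB] : exists B, B = 2 ^ (2 ^ ((c + 7) * X)) by eexists.
have X0 : 0 < X by rewrite -hX.
have B32 : 32 <= B by rewrite hB double_exp_ge32.
have leB : 2 ^ (2 ^ (c * X)) <= B by rewrite hB; exact: double_exp_mono.
have small_input : all (fun n => 2 * n.+1 <= B) [:: s; r; u.1; u.2].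
  have ltX x : x <= s + r -> x < 2 ^ X.
    by move=> le; have := ltn_expl X (isT : 1 < 2); rewrite -hX; apply: leq_ltn_trans; lia.
  have leX : 2 ^ r <= 2 ^ X by rewrite leq_exp2l // -hX; lia.
  rewrite hB; case: Ju => lt1 lt2; apply/and5P; split; last exact: isT.
  - exact/double_exp_ge/ltX/leq_addr.
  - exact/double_exp_ge/ltX/leq_addl.
  - exact/double_exp_ge/(leq_trans lt1 leX).
  - exact/double_exp_ge/(leq_trans lt2 leX).
have [L [rho hp]] := ex_program B32 small_input (val_mono hm leB) (val_mono ha leB).
pose w := encode_input [:: s; r; u.1; u.2].
have inputE : [seq sym x | x <- w] = input_cells [:: s; r; u.1; u.2].
  by rewrite /w /encode_input /input_cells /bit_cells /= cats0 !map_cat !map_rcons -!map_comp cats0.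
(* The machine has only tapes 0 to [n]. The fictitious ones beyond carry the marker from the start,
   so that [represents] holds for every register once [init_regs n] has run. *)
pose g i := if i <= n then word_tape unit (if i == 0 then w else [::])
            else Tape [::] marker [::].
have [g1 [e1 g10 g1S]] := exec_init_regs n g.
have rep1 : represents (scan_tape [::] (input_cells [:: s; r; u.1; u.2]), fun _ => 0) g1.
  split; first by rewrite g10 /g /= -inputE.
  by move=> q; exists 0; rewrite g1S /g /=; case: ltnP.
have [t [g2 [let' e2 [g20 _]]]] := hp g1 rep1.
pose a := fa s r u; pose m := fm s r u.
exists (map Some (mkseq (fun i => odd (a %/ 2 ^ i)) a) ++
        None :: map Some (rcons (nseq m false) true)); split; last first.
  exists (mkseq (fun i => odd (a %/ 2 ^ i)) a), (rcons (nseq m false) true).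
  split=> //; first by rewrite bits_val_pow2 -lt0n expn_gt0.
  by rewrite bits_val_pow2 bits_val_mkseq // ltn_expl.
have -> : map Some (mkseq (fun i => odd (a %/ 2 ^ i)) a) ++
        None :: map Some (rcons (nseq m false) true) = tape_word (g2 0).
  rewrite g20 -[LHS](tape_word_cells L) /output_cells /bit_cells.
  by rewrite map_cat map_cons -!map_comp.
apply: (@runs_to_machine_of n _ (n.+1 + t) _ _ g).
- exact: exec_seq e1 e2.
- rewrite -[max_index _]/(maxn (max_index (init_regs n)) (max_index (program Em Ea))).
  by rewrite max_index_init_regs geq_max leqnn hn.
- by apply: double_exp_time => //; rewrite -hB.
- by move=> i le; rewrite /g le.
Qed.

(** * Bounds on intermediate values *)

Fixpoint rename (f : nat -> nat) (e : expr) : expr :=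
  match e with
  | Var i => Var (f i)
  | Zero => Zero
  | Succ e => Succ (rename f e)
  | Pred e => Pred (rename f e)
  | Rec e0 e1 e2 => Rec (rename f e0) (rename f e1)
      (rename (fun i => if i is i'.+2 then (f i').+2 else i) e2)
  end.

Lemma val_rename B e l v : evals B e l v -> forall f l',
  (forall i, i < size l -> f i < size l' /\ nth 0 l' (f i) = nth 0 l i) ->
  evals B (rename f e) l' v.
Proof.
elim=> {e l v}.
- move=> i l lt le f l' h; have [lt' e] := h i lt.
  by apply: val_nth; rewrite ?e.
- by move=> l f l' _; apply: val_zero.
- by move=> e l v _ IH lt f l' h; apply: val_succ => //; apply: IH.
- by move=> e l v _ IH f l' h; apply: val_pred; apply: IH.
move=> e0 e1 e2 l n F _ IH0 _ IH1 _ IH2 f l' h.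
apply: val_rec; [exact: IH0 | exact: IH1 | move=> i lt; apply: IH2 => //].
by case=> [|[|j]] //=; rewrite !ltnS; apply: h.
Qed.

Definition Lift (e : expr) := rename succn e.

Lemma val_lift B e l v x : evals B e l v -> evals B (Lift e) (x :: l) v.
Proof. by move=> /val_rename; apply. Qed.

Definition Const n := iter n Succ Zero.
Definition SubE a b := Rec a b (Pred (Var 0)).
Definition MulE a b := Rec Zero b (AddE (Var 0) (Lift (Lift a))).
Definition Pow2E a := Rec (Succ Zero) a (AddE (Var 0) (Var 0)).
Definition LeE a b := IsZeroE (SubE a b).
(** [f] sees the summation index as variable 0; the renaming makes room for the accumulator in front
    of it. *)
Definition SumE n f :=
  Rec Zero n (AddE (Var 0) (rename succn f)).
(** For positive [b], the quotient counts the [k < a] with [(k + 1) b <= a]. *)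
Definition DivE a b := SumE a (LeE (MulE (Succ (Var 0)) (Lift b)) (Lift a)).
Definition ModE a b := SubE a (MulE (DivE a b) b).

Lemma sum_ltn_const m n : \sum_(0 <= k < n) (k < m) = minn n m.
Proof.
elim: n => [|n IH]; first by rewrite big_geq ?min0n.
by rewrite big_nat_recr //= IH; lia.
Qed.

Section Bounds.
Variable M : nat.
Hypothesis M0 : 0 < M.
Local Notation Om := (2 ^ M).
Implicit Types (a b e : expr) (l : seq nat) (i j n x y : nat).

(** The degree [j] in [Om = 2 ^ M] behaves like that of a polynomial: it adds up under products.
    Quantifying over [D] lets subexpressions of different degrees be evaluated under a common
    bound. *)
Definition bounded e l v j := forall D, j <= D -> evals (Om ^ D) e l v /\ v <= Om ^ j.

Lemma Om_gt1 : 1 < Om. Proof. by rewrite -{1}(expn0 2) ltn_exp2l. Qed.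

Lemma Om_mono i j : i <= j -> Om ^ i <= Om ^ j.
Proof. by move=> le; rewrite leq_exp2l // Om_gt1. Qed.

Lemma Om_gt0 i : 0 < Om ^ i. Proof. by rewrite expn_gt0 expn_gt0. Qed.

Lemma bounded_le e l v j : bounded e l v j -> v <= Om ^ j.
Proof. by case/(_ j (leqnn j)). Qed.

Lemma bounded_val e l v j D : bounded e l v j -> j <= D -> evals (Om ^ D) e l v.
Proof. by move=> h /h[]. Qed.

Lemma bounded_eq e l v v' j : bounded e l v j -> v = v' -> bounded e l v' j.
Proof. by move=> h <-. Qed.

Lemma bounded_mono e l v i j : bounded e l v i -> i <= j -> bounded e l v j.
Proof.
move=> h le D leD; split; first by apply: bounded_val h (leq_trans le leD).
exact: leq_trans (bounded_le h) (Om_mono le).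
Qed.

Lemma bounded_var i l v j : i < size l -> nth 0 l i = v -> v <= Om ^ j ->
  bounded (Var i) l v j.
Proof.
move=> lt e le D leD; split=> //; apply: val_nth => //.
exact: leq_trans (Om_mono leD).
Qed.

Lemma bounded_lift e l v j x : bounded e l v j -> bounded (Lift e) (x :: l) v j.
Proof. by move=> h D /h[h1 h2]; split=> //; apply: val_lift. Qed.

Lemma bounded_succ e l v j : bounded e l v j -> bounded (Succ e) l v.+1 j.+1.
Proof.
move=> h D leD; have le := bounded_le h.
have lt : v < Om ^ j.+1 by apply: leq_ltn_trans le _; rewrite ltn_exp2l // Om_gt1.
split=> //; apply: val_succ; first by apply: bounded_val h (ltnW leD).
exact: leq_trans lt (Om_mono leD).
Qed.

Lemma bounded_const n l : bounded (Const n) l n n.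
Proof.
elim: n => [|n IH]; last exact: bounded_succ.
by move=> D _; split=> //; apply: val_zero.
Qed.

Lemma bounded_add a b l x y i j : bounded a l x i -> bounded b l y j ->
  bounded (AddE a b) l (x + y) (i + j).+1.
Proof.
move=> ha hb D leD.
have le : x + y <= Om ^ (i + j).+1.
  rewrite expnS; apply: leq_trans (_ : 2 * Om ^ (i + j) <= _); last first.
    by rewrite leq_mul2r Om_gt1 orbT.
  rewrite mul2n -addnn leq_add // ?(leq_trans (bounded_le ha)) ?(leq_trans (bounded_le hb)) //.
    by apply/Om_mono/leq_addr.
  by apply/Om_mono/leq_addl.
split=> //; apply: val_add.
- exact: Om_gt0.
- by apply: bounded_val ha _; lia.
- by apply: bounded_val hb _; lia.
- exact: leq_trans le (Om_mono leD).
Qed.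

Lemma bounded_sub a b l x y i j : bounded a l x i -> bounded b l y j ->
  bounded (SubE a b) l (x - y) (i + j).
Proof.
move=> ha hb D leD; have le : x - y <= Om ^ (i + j).
  apply: leq_trans (leq_subr _ _) (leq_trans (bounded_le ha) _).
  exact/Om_mono/leq_addr.
split=> //.
apply: (@val_rec_to _ _ _ _ _ y (fun k => x - (y - k))).
- by rewrite subnn subn0; apply: bounded_val ha _; lia.
- by apply: bounded_val hb _; lia.
- move=> k lt; apply: (@val_eq _ _ _ (x - (y - k.+1)).-1); last by lia.
  apply: val_pred; apply: val_nth => //=.
  apply: leq_trans (leq_subr _ _) (leq_trans (bounded_le ha) (Om_mono _)); lia.
- by rewrite subn0.
Qed.

Lemma bounded_mul a b l x y i j : bounded a l x i -> bounded b l y j ->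
  bounded (MulE a b) l (x * y) (i + j).
Proof.
move=> ha hb D leD.
have leM z : z <= y -> x * z <= Om ^ (i + j).
  move=> lez; rewrite expnD leq_mul ?(bounded_le ha) //.
  exact: leq_trans (bounded_le hb).
split; last exact: leM.
have leMD z : z <= y -> x * z <= Om ^ D.
  by move=> /leM /leq_trans; apply; apply: Om_mono.
apply: (@val_rec_to _ _ _ _ _ y (fun k => x * (y - k))).
- by rewrite subnn muln0; apply: val_zero.
- by apply: bounded_val hb _; lia.
- move=> k lt; apply: (@val_eq _ _ _ (x * (y - k.+1) + x)); last first.
    by rewrite -mulnSr subnSK.
  apply: val_add.
  + exact: Om_gt0.
  + by apply: val_nth => //=; apply: leMD; apply: leq_subr.
  + by do 2 apply: val_lift; apply: bounded_val ha _; lia.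
  + by rewrite -mulnSr subnSK //; apply: leMD; apply: leq_subr.
- by rewrite subn0.
Qed.

(** An exponent only known to be polynomial in [Om] would be too large; the exponents below are all
    linear in [M]. *)
Lemma bounded_pow2 a l x i c : bounded a l x i -> x <= c * M ->
  bounded (Pow2E a) l (2 ^ x) (i + c).
Proof.
move=> ha le D leD.
have leP z : z <= x -> 2 ^ z <= Om ^ (i + c).
  move=> lez; rewrite -expnM leq_exp2l // (leq_trans lez) // (leq_trans le) //.
  by rewrite mulnC leq_mul2l leq_addl orbT.
split; last exact: leP.
have lePD z : z <= x -> 2 ^ z <= Om ^ D.
  by move=> /leP /leq_trans; apply; apply: Om_mono.
apply: (@val_rec_to _ _ _ _ _ x (fun k => 2 ^ (x - k))).
- rewrite subnn; apply: val_succ (Om_gt0 _); exact: val_zero.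
- by apply: bounded_val ha _; lia.
- move=> k lt.
  have e2 : 2 ^ (x - k) = 2 ^ (x - k.+1) + 2 ^ (x - k.+1).
    by rewrite addnn -mul2n -expnS subnSK.
  rewrite e2; apply: val_add.
  + exact: Om_gt0.
  + by apply: val_nth => //=; apply: lePD; apply: leq_subr.
  + by apply: val_nth => //=; apply: lePD; apply: leq_subr.
  + by rewrite -e2; apply: lePD; apply: leq_subr.
- by rewrite subn0.
Qed.

Lemma bounded_leE a b l x y i j : bounded a l x i -> bounded b l y j ->
  bounded (LeE a b) l (x <= y) (i + j).
Proof.
move=> ha hb D leD; split; last by apply: leq_trans (leq_b1 _) (Om_gt0 _).
rewrite -subn_eq0; apply: val_is_zero; first exact: Om_gt0.
by apply: bounded_val leD; apply: bounded_sub.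
Qed.

Lemma bounded_sum a e l n f i j : bounded a l n i ->
  (forall k, k < n -> bounded e (k :: l) (f k) j) ->
  bounded (SumE a e) l (\sum_(0 <= k < n) f k) (i + j).
Proof.
move=> ha he D leD.
have leS k : \sum_(k <= k' < n) f k' <= Om ^ (i + j).
  apply: leq_trans (_ : \sum_(k <= k' < n) Om ^ j <= _).
    by rewrite big_nat [leqRHS]big_nat; apply: leq_sum => q /andP[_ /he /bounded_le].
  rewrite sum_nat_const_nat expnD leq_mul2r; apply/orP; right.
  exact: leq_trans (leq_subr _ _) (bounded_le ha).
have leSD k : \sum_(k <= k' < n) f k' <= Om ^ D.
  exact: leq_trans (leS k) (Om_mono leD).
split; last exact: leS.
apply: (@val_rec_to _ _ _ _ _ n (fun k => \sum_(k <= k' < n) f k')) => //.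
- by rewrite big_geq //; apply: val_zero.
- by apply: bounded_val ha _; lia.
- move=> k lt; rewrite [X in evals _ _ _ X]big_ltn // addnC; apply: val_add.
  + exact: Om_gt0.
  + exact: val_nth.
  + have hk : evals (Om ^ D) e (k :: l) (f k) by apply: bounded_val (he k lt) _; lia.
    exact: val_rename hk _ _ _.
  + by rewrite addnC -big_ltn.
Qed.

Lemma bounded_div a b l x y i j : bounded a l x i -> bounded b l y j -> 0 < y ->
  bounded (DivE a b) l (x %/ y) (3 * i + j + 1).
Proof.
move=> ha hb y0.
have -> : x %/ y = \sum_(0 <= k < x) (k.+1 * y <= x).
  rewrite (eq_big_nat _ _ (F2 := fun k => k < x %/ y : nat)); last first.
    by move=> k _; rewrite leq_divRL.
  by rewrite sum_ltn_const (minn_idPr _) // leq_div.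
apply: bounded_mono (_ : bounded _ _ _ (i + (((i.+1) + j) + i))) _; last by lia.
apply: (bounded_sum ha) => k lt.
apply: bounded_leE; last exact: bounded_lift.
apply: bounded_mul; last exact: bounded_lift.
apply: bounded_succ; apply: bounded_var => //.
exact: leq_trans (ltnW lt) (bounded_le ha).
Qed.

Lemma bounded_mod a b l x y i j : bounded a l x i -> bounded b l y j -> 0 < y ->
  bounded (ModE a b) l (x %% y) (4 * i + 2 * j + 1).
Proof.
move=> ha hb y0; apply: (@bounded_eq _ _ (x - x %/ y * y)); last first.
  by rewrite {1}(divn_eq x y) addKn.
apply: bounded_mono (_ : bounded _ _ _ (i + (3 * i + j + 1 + j))) _; last by lia.
by apply: bounded_sub => //; apply: bounded_mul => //; apply: bounded_div.
Qed.

End Bounds.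

(** * The squares *)

(* At stage [k] the squares have side [2^-lvl k] and [x_k = num k / 2^wid k].
   The prefix of length [k * k] of the slope is the integer [A]. *)
Definition lev k := trunc_log 16 k.
Definition wid k := 3 * lev k.
Definition num k := k - 2 ^ (4 * lev k).
Definition lvl k := k * k + wid k.
(* The block [a_i] of digits, read off the prefix [A]. *)
Definition digit A k i := A %/ 2 ^ (k * k - i.+1 * i.+1) %% 2 ^ (2 * i).+1.
(* In units of [2^-lvl k], minus the value at 0 of the line of prefix [A]. *)
Definition offset A k :=
  \sum_(0 <= i < k) digit A k i * num i * 2 ^ (lvl k - (i.+1 * i.+1 + wid i)).
(* Multiplication by [opp k] is the opposite modulo [2^lvl k]: subtractions
   are avoided this way below. *)
Definition opp k := 2 ^ lvl k - 1.
Definition height A w k :=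
  A * num k + A * w %/ 2 ^ (k * k) + opp k * offset A k.
(* Up to an error absorbed by [e - 4], where [e < 8], the coordinates of
   [(+- y, t - y)] at [t = (num k * 2^(k * k) + w) / 2^lvl k]; [g = 1] selects
   the sign minus. *)
Definition coord1 g A w k e :=
  (1 + g * (opp k - 1)) * height A w k + (4 * opp k + e).
Definition coord2 A w k e :=
  num k * 2 ^ (k * k) + w + opp k * height A w k + (4 * opp k + e).
(* The dyadic intervals [c, c + 1) / 2^m and [u, u + 1) / 2^r meet, hence one
   of them contains the other. *)
Definition meets m c r u := (c * 2 ^ r < u.+1 * 2 ^ m) * (u * 2 ^ m < c.+1 * 2 ^ r).
Definition cell_meets k X r u := meets (lvl k) (X %% 2 ^ lvl k) r u.
Definition hits k r (u : nat * nat) :=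
  \sum_(0 <= g < 2) \sum_(0 <= A < 2 * 2 ^ (k * k)) \sum_(0 <= w < 2 ^ (k * k))
  \sum_(0 <= e1 < 8) \sum_(0 <= e2 < 8)
    cell_meets k (coord1 g A w k e1) r u.1 * cell_meets k (coord2 A w k e2) r u.2.
Definition cutoff s r := 2 ^ (4 * (s + r + 7)).
Definition numer s r u :=
  \sum_(0 <= k < cutoff s r)
    2 ^ (2 * (cutoff s r * cutoff s r - (lvl k - r))) * hits k r u.

Lemma lev_le k : 0 < k -> 16 ^ lev k <= k.
Proof. by move=> k0; have /andP[] := trunc_log_bounds (isT : 1 < 16) k0. Qed.

Lemma lev_gt k : k < 16 ^ (lev k).+1.
Proof. exact: trunc_log_ltn. Qed.

Lemma wid_le k : wid k <= k.
Proof.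
case: k => [|k]; first by rewrite /wid /lev trunc_log0.
apply: leq_trans (lev_le _) => //; rewrite /wid; elim: (lev _) => // l IH.
by rewrite expnS; lia.
Qed.

(** The logarithm in a form that [SumE] can compute. *)
Lemma lev_sum k : lev k = \sum_(0 <= j < k) (2 ^ (4 * j.+1) <= k).
Proof.
case: k => [|k]; first by rewrite big_geq // /lev trunc_log0.
rewrite (eq_big_nat _ _ (F2 := fun j => j < lev k.+1 : nat)); last first.
  move=> j _; rewrite expnM -[2 ^ 4]/16; congr nat_of_bool; apply/idP/idP => h.
    by apply: trunc_log_max.
  by apply: leq_trans (lev_le _) => //; rewrite leq_exp2l.
rewrite sum_ltn_const (minn_idPr _) //.
by have := wid_le k.+1; rewrite /wid; lia.
Qed.

(** * Expressions for the counts of squares, with uniform bounds *)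

Definition LevE a := SumE a (LeE (Pow2E (MulE (Const 4) (Succ (Var 0)))) (Lift a)).
Definition WidE a := MulE (Const 3) (LevE a).
Definition NumE a := SubE a (Pow2E (MulE (Const 4) (LevE a))).
Definition SqE a := MulE a a.
Definition LvlE a := AddE (SqE a) (WidE a).
Definition DigitE A k i :=
  ModE (DivE A (Pow2E (SubE (SqE k) (SqE (Succ i))))) (Pow2E (Succ (MulE (Const 2) i))).
Definition OffsetE A k :=
  SumE k (MulE (MulE (DigitE (Lift A) (Lift k) (Var 0)) (NumE (Var 0)))
    (Pow2E (SubE (LvlE (Lift k)) (AddE (SqE (Succ (Var 0))) (WidE (Var 0)))))).
Definition OppE k := SubE (Pow2E (LvlE k)) (Const 1).
Definition HeightE A w k :=
  AddE (AddE (MulE A (NumE k)) (DivE (MulE A w) (Pow2E (SqE k))))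
       (MulE (OppE k) (OffsetE A k)).
Definition Coord1E g A w k e :=
  AddE (MulE (AddE (Const 1) (MulE g (SubE (OppE k) (Const 1)))) (HeightE A w k))
       (AddE (MulE (Const 4) (OppE k)) e).
Definition Coord2E A w k e :=
  AddE (AddE (AddE (MulE (NumE k) (Pow2E (SqE k))) w) (MulE (OppE k) (HeightE A w k)))
       (AddE (MulE (Const 4) (OppE k)) e).
Definition LtE a b := LeE (Succ a) b.
Definition MeetsE m c r u :=
  MulE (LtE (MulE c (Pow2E r)) (MulE (Succ u) (Pow2E m)))
       (LtE (MulE u (Pow2E m)) (MulE (Succ c) (Pow2E r))).
Definition CellMeetsE k X r u := MeetsE (LvlE k) (ModE X (Pow2E (LvlE k))) r u.
(** Below the five sums, the variables 4 down to 0 are [g], [A], [w], [e1] and [e2]. *)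
Definition HitsE k r u1 u2 :=
  let L1 e := Lift e in let L2 e := Lift (L1 e) in let L3 e := Lift (L2 e) in
  let L4 e := Lift (L3 e) in let L5 e := Lift (L4 e) in
  SumE (Const 2) (SumE (MulE (Const 2) (Pow2E (SqE (L1 k))))
   (SumE (Pow2E (SqE (L2 k))) (SumE (Const 8) (SumE (Const 8)
     (MulE (CellMeetsE (L5 k) (Coord1E (Var 4) (Var 3) (Var 2) (L5 k) (Var 1)) (L5 r) (L5 u1))
           (CellMeetsE (L5 k) (Coord2E (Var 3) (Var 2) (L5 k) (Var 0)) (L5 r) (L5 u2))))))).
Definition CutoffE := Pow2E (MulE (Const 4) (AddE (AddE (Var 0) (Var 1)) (Const 7))).
Definition NumerE :=
  SumE CutoffE (MulE
    (Pow2E (MulE (Const 2) (SubE (SqE (Lift CutoffE)) (SubE (LvlE (Var 0)) (Var 2)))))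
    (HitsE (Var 0) (Var 2) (Var 3) (Var 4))).
Definition DenomE := MulE (Const 2) (SqE CutoffE).

(** Here and below, [j] is chosen before [M] and all values, hence is a constant; [eexists] lets the
    rules for the operations determine it. *)
Lemma bounded_lev i : exists j, forall M a l k, 0 < M -> bounded M a l k i ->
  k * k <= M -> bounded M (LevE a) l (lev k) j.
Proof.
eexists=> M a l k M0 ha le; rewrite lev_sum.
apply: (bounded_sum M0 ha) => x lt.
apply: (bounded_leE M0); last by apply: bounded_lift ha.
apply: (bounded_pow2 (c := 4) M0); last by nia.
apply: (bounded_mul M0); first exact: bounded_const.
apply: (bounded_succ M0); apply: (bounded_var (j := i) M0) => //.
exact: leq_trans (ltnW lt) (bounded_le ha).
Qed.

Lemma bounded_wid i : exists j, forall M a l k, 0 < M -> bounded M a l k i ->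
  k * k <= M -> bounded M (WidE a) l (wid k) j.
Proof.
have [j1 h1] := bounded_lev i.
eexists=> M a l k M0 ha le.
by apply: (bounded_mul M0); [apply: bounded_const | apply: h1 le].
Qed.

Lemma bounded_num i : exists j, forall M a l k, 0 < M -> bounded M a l k i ->
  k * k <= M -> bounded M (NumE a) l (num k) j.
Proof.
have [j1 h1] := bounded_lev i.
eexists=> M a l k M0 ha le.
apply: (bounded_sub M0 ha); apply: (bounded_pow2 (c := 4) M0).
  by apply: (bounded_mul M0); [apply: bounded_const | apply: h1 le].
by have := wid_le k; rewrite /wid; nia.
Qed.

Lemma bounded_lvl i : exists j, forall M a l k, 0 < M -> bounded M a l k i ->
  k * k <= M -> bounded M (LvlE a) l (lvl k) j.
Proof.
have [j1 h1] := bounded_wid i.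
eexists=> M a l k M0 ha le.
apply: (bounded_add M0); last exact: h1 le.
exact: (bounded_mul M0 ha ha).
Qed.

Lemma lvl_le k M : k * k <= M -> lvl k <= 2 * M.
Proof. by move=> le; have := wid_le k; rewrite /lvl; nia. Qed.

Lemma bounded_digit iA ik ii : exists j, forall M a b c l A k i, 0 < M ->
  bounded M a l A iA -> bounded M b l k ik -> bounded M c l i ii ->
  k * k <= M -> i < k -> bounded M (DigitE a b c) l (digit A k i) j.
Proof.
eexists=> M a b c l A k i M0 ha hb hc le lt.
apply: (bounded_mod M0); last by rewrite expn_gt0.
  apply: (bounded_div M0 ha); last by rewrite expn_gt0.
  apply: (bounded_pow2 (c := 1) M0); last by lia.
  apply: (bounded_sub M0); first exact: (bounded_mul M0 hb hb).
  by apply: (bounded_mul M0); exact: (bounded_succ M0 hc).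
apply: (bounded_pow2 (c := 2) M0); last by nia.
by apply: (bounded_succ M0); apply: (bounded_mul M0 _ hc); apply: bounded_const.
Qed.

Lemma bounded_offset iA ik : exists j, forall M a b l A k, 0 < M ->
  bounded M a l A iA -> bounded M b l k ik -> k * k <= M ->
  bounded M (OffsetE a b) l (offset A k) j.
Proof.
have [j1 h1] := bounded_digit iA ik ik.
have [j2 h2] := bounded_num ik; have [j3 h3] := bounded_lvl ik.
have [j4 h4] := bounded_wid ik.
eexists=> M a b l A k M0 ha hb le.
apply: (bounded_sum M0 hb) => i lt.
have hi : bounded M (Var 0) (i :: l) i ik.
  apply: (bounded_var M0) => //; exact: leq_trans (ltnW lt) (bounded_le hb).
have hb' := bounded_lift i hb; have ha' := bounded_lift i ha.
have lei : i * i <= M by nia.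
apply: (bounded_mul M0).
  by apply: (bounded_mul M0); [apply: h1 le lt | apply: h2 lei].
apply: (bounded_pow2 (c := 2) M0).
  apply: (bounded_sub M0); first exact: h3 le.
  apply: (bounded_add M0); last exact: h4 lei.
  by apply: (bounded_mul M0); exact: (bounded_succ M0 hi).
exact: leq_trans (leq_subr _ _) (lvl_le le).
Qed.

Lemma bounded_opp i : exists j, forall M a l k, 0 < M -> bounded M a l k i ->
  k * k <= M -> bounded M (OppE a) l (opp k) j.
Proof.
have [j1 h1] := bounded_lvl i.
eexists=> M a l k M0 ha le.
apply: (bounded_sub M0); last exact: bounded_const.
by apply: (bounded_pow2 (c := 2) M0); [apply: h1 le | apply: lvl_le].
Qed.

Lemma bounded_height iA iw ik : exists j, forall M a b c l A w k, 0 < M ->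
  bounded M a l A iA -> bounded M b l w iw -> bounded M c l k ik -> k * k <= M ->
  bounded M (HeightE a b c) l (height A w k) j.
Proof.
have [j1 h1] := bounded_num ik; have [j2 h2] := bounded_opp ik.
have [j3 h3] := bounded_offset iA ik.
eexists=> M a b c l A w k M0 ha hb hc le.
apply: (bounded_add M0); last first.
  by apply: (bounded_mul M0); [apply: h2 le | apply: h3 le].
apply: (bounded_add M0).
  by apply: (bounded_mul M0 ha); apply: h1 le.
apply: (bounded_div M0); last by rewrite expn_gt0.
  exact: (bounded_mul M0 ha hb).
by apply: (bounded_pow2 (c := 1) M0); [apply: (bounded_mul M0 hc hc) | lia].
Qed.

Lemma bounded_coord1 ig iA iw ik ie : exists j, forall M a0 a b c d l g A w k e,
  0 < M -> bounded M a0 l g ig ->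
  bounded M a l A iA -> bounded M b l w iw -> bounded M c l k ik ->
  bounded M d l e ie -> k * k <= M ->
  bounded M (Coord1E a0 a b c d) l (coord1 g A w k e) j.
Proof.
have [j1 h1] := bounded_opp ik; have [j2 h2] := bounded_height iA iw ik.
eexists=> M a0 a b c d l g A w k e M0 hg ha hb hc he le.
have ho := h1 _ _ _ _ M0 hc le.
apply: (bounded_add M0).
  apply: (bounded_mul M0); last exact: h2 le.
  apply: (bounded_add M0); first exact: bounded_const.
  apply: (bounded_mul M0 hg); apply: (bounded_sub M0 ho); exact: bounded_const.
apply: (bounded_add M0 _ he); apply: (bounded_mul M0 _ ho); exact: bounded_const.
Qed.

Lemma bounded_coord2 iA iw ik ie : exists j, forall M a b c d l A w k e, 0 < M ->
  bounded M a l A iA -> bounded M b l w iw -> bounded M c l k ik ->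
  bounded M d l e ie -> k * k <= M ->
  bounded M (Coord2E a b c d) l (coord2 A w k e) j.
Proof.
have [j1 h1] := bounded_opp ik; have [j2 h2] := bounded_height iA iw ik.
have [j3 h3] := bounded_num ik.
eexists=> M a b c d l A w k e M0 ha hb hc he le.
have ho := h1 _ _ _ _ M0 hc le.
apply: (bounded_add M0).
  apply: (bounded_add M0); last by apply: (bounded_mul M0 ho); apply: h2 le.
  apply: (bounded_add M0 _ hb); apply: (bounded_mul M0); first exact: h3 le.
  by apply: (bounded_pow2 (c := 1) M0); [apply: (bounded_mul M0 hc hc) | lia].
apply: (bounded_add M0 _ he); apply: (bounded_mul M0 _ ho); exact: bounded_const.
Qed.

Lemma bounded_cell_meets ik iX ir iu : exists j, forall M a b c d l k X r u, 0 < M ->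
  bounded M a l k ik -> bounded M b l X iX -> bounded M c l r ir ->
  bounded M d l u iu -> k * k <= M -> r <= M ->
  bounded M (CellMeetsE a b c d) l (cell_meets k X r u) j.
Proof.
have [j1 h1] := bounded_lvl ik.
eexists=> M a b c d l k X r u M0 hk hX hr hu le ler.
have h2m : bounded M (Pow2E (LvlE a)) l (2 ^ lvl k) (j1 + 2).
  by apply: (bounded_pow2 M0); [apply: h1 le | apply: lvl_le].
have h2r : bounded M (Pow2E c) l (2 ^ r) (ir + 1).
  by apply: (bounded_pow2 M0 hr); lia.
have hc := bounded_mod M0 hX h2m (expn_gt0 2 _).
apply: (bounded_mul M0); apply: (bounded_leE M0).
- by apply: (bounded_succ M0); apply: (bounded_mul M0 hc h2r).
- by apply: (bounded_mul M0) h2m; apply: (bounded_succ M0 hu).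
- by apply: (bounded_succ M0); apply: (bounded_mul M0 hu h2m).
- by apply: (bounded_mul M0) h2r; apply: (bounded_succ M0 hc).
Qed.

Lemma bounded_hits ik ir i1 i2 : exists j, forall M a b c d l k r u, 0 < M ->
  bounded M a l k ik -> bounded M b l r ir ->
  bounded M c l u.1 i1 -> bounded M d l u.2 i2 -> k * k <= M -> r <= M ->
  bounded M (HitsE a b c d) l (hits k r u) j.
Proof.
pose iw := ik + ik + 1; pose iA := 2 + iw.
have [j1 h1] := bounded_coord1 2 iA iw ik 8.
have [j2 h2] := bounded_coord2 iA iw ik 8.
have [j3 h3] := bounded_cell_meets ik j1 ir i1.
have [j4 h4] := bounded_cell_meets ik j2 ir i2.
eexists=> M a b c d l k r u M0 hk hr hu1 hu2 le ler.
have hw l' e : bounded M e l' k ik ->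
    bounded M (Pow2E (SqE e)) l' (2 ^ (k * k)) iw.
  by move=> he; apply: (bounded_pow2 M0); [apply: (bounded_mul M0 he he) | lia].
have hA l' e : bounded M e l' k ik ->
    bounded M (MulE (Const 2) (Pow2E (SqE e))) l' (2 * 2 ^ (k * k)) iA.
  by move=> he; apply: (bounded_mul M0); [apply: bounded_const | apply: hw].
have h8 n : n < 8 -> n <= (2 ^ M) ^ 8.
  by move=> lt; exact: leq_trans (ltnW lt) (bounded_le (bounded_const M0 (n := 8) [::])).
apply: (bounded_sum M0 (bounded_const M0 (n := 2) l)) => g ltg.
apply: (bounded_sum M0) => [|A ltA]; first exact/hA/bounded_lift.
apply: (bounded_sum M0) => [|w ltw]; first exact/hw/bounded_lift/bounded_lift.
apply: (bounded_sum M0 (bounded_const M0 (n := 8) _)) => e1 lt1.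
apply: (bounded_sum M0 (bounded_const M0 (n := 8) _)) => e2 lt2.
have lift5 e v i : bounded M e l v i ->
    bounded M (Lift (Lift (Lift (Lift (Lift e))))) [:: e2, e1, w, A, g & l] v i.
  by move=> he; do 5 apply: bounded_lift.
have vg : bounded M (Var 4) [:: e2, e1, w, A, g & l] g 2.
  apply: (bounded_var M0) => //.
  exact: leq_trans (ltnW ltg) (bounded_le (bounded_const M0 (n := 2) [::])).
have vA : bounded M (Var 3) [:: e2, e1, w, A, g & l] A iA.
  by apply: (bounded_var M0) => //; apply: leq_trans (ltnW ltA) (bounded_le (hA _ _ hk)).
have vw : bounded M (Var 2) [:: e2, e1, w, A, g & l] w iw.
  by apply: (bounded_var M0) => //; apply: leq_trans (ltnW ltw) (bounded_le (hw _ _ hk)).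
have v1 : bounded M (Var 1) [:: e2, e1, w, A, g & l] e1 8.
  by apply: (bounded_var M0) => //; apply: h8.
have v2 : bounded M (Var 0) [:: e2, e1, w, A, g & l] e2 8.
  by apply: (bounded_var M0) => //; apply: h8.
have hk' := lift5 _ _ _ hk.
apply: (bounded_mul M0).
  apply: (h3 _ _ _ _ _ _ _ _ _ _ M0 hk' _ (lift5 _ _ _ hr) (lift5 _ _ _ hu1) le ler).
  exact: (h1 _ _ _ _ _ _ _ _ _ _ _ _ M0 vg vA vw hk' v1 le).
apply: (h4 _ _ _ _ _ _ _ _ _ _ M0 hk' _ (lift5 _ _ _ hr) (lift5 _ _ _ hu2) le ler).
exact: (h2 _ _ _ _ _ _ _ _ _ _ M0 vA vw hk' v2 le).
Qed.

Lemma cutoff_ge s r : 4 * (s + r + 7) <= cutoff s r.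
Proof. exact/ltnW/ltn_expl. Qed.

Lemma bounded_numer : exists j, forall s r u, Defs.J r u ->
  let M := cutoff s r * cutoff s r in
  bounded M DenomE [:: s; r; u.1; u.2] (2 * M) j /\
  bounded M NumerE [:: s; r; u.1; u.2] (numer s r u) j.
Proof.
pose ic := 4 + (1 + 1).+1 + 7.+1 + 1.
(* The degree that the rules yield for [CutoffE]; it also bounds every index [k < cutoff s r]. *)
pose it := 4 + ((1 + 1).+1 + 7).+1 + 1.
have [jl hl] := bounded_lvl it.
have [jh hh] := bounded_hits it 1 1 1.
suff [j2 [j3 h]] : exists j2 j3, forall s r u, Defs.J r u ->
    let M := cutoff s r * cutoff s r in
    bounded M DenomE [:: s; r; u.1; u.2] (2 * M) j2 /\
    bounded M NumerE [:: s; r; u.1; u.2] (numer s r u) j3.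
  exists (j2 + j3) => s r u Ju; have [a b] := h s r u Ju; split.
    by apply: (bounded_mono _ a (leq_addr _ _)); rewrite muln_gt0 !expn_gt0.
  by apply: (bounded_mono _ b (leq_addl _ _)); rewrite muln_gt0 !expn_gt0.
eexists; eexists=> s r u [lt1 lt2] M.
have cge := cutoff_ge s r.
have lecM : cutoff s r <= M by rewrite /M leq_pmulr // expn_gt0.
have M0 : 0 < M by apply: leq_trans lecM; rewrite expn_gt0.
have le1 x : x < 2 ^ M -> x <= (2 ^ M) ^ 1 by rewrite expn1 => /ltnW.
have leu x : x < 2 ^ r -> x < 2 ^ M.
  by move=> /leq_trans; apply; rewrite leq_exp2l //; lia.
have lex x : x <= M -> x < 2 ^ M by move=> /leq_ltn_trans; apply; apply: ltn_expl.
have hc : bounded M CutoffE [:: s; r; u.1; u.2] (cutoff s r) it.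
  apply: (bounded_pow2 M0); last by lia.
  apply: (bounded_mul M0 (bounded_const M0 (n := 4) _)).
  apply: (bounded_add M0 _ (bounded_const M0 (n := 7) _)).
  apply: (bounded_add M0); apply: (bounded_var M0) => //; apply: le1; apply: lex; lia.
split.
  apply: (bounded_mul M0 (bounded_const M0 (n := 2) _)); exact: (bounded_mul M0 hc hc).
apply: (bounded_sum M0 hc) => k lt.
set l := [:: k; _; _; _; _].
have vk : bounded M (Var 0) l k it.
  by apply: (bounded_var M0) => //; apply: leq_trans (ltnW lt) (bounded_le hc).
have vr : bounded M (Var 2) l r 1.
  by apply: (bounded_var M0) => //; apply: le1; apply: lex; lia.
have v1 : bounded M (Var 3) l u.1 1.
  by apply: (bounded_var M0) => //; apply/le1/leu.
have v2 : bounded M (Var 4) l u.2 1.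
  by apply: (bounded_var M0) => //; apply/le1/leu.
have lek : k * k <= M by rewrite /M leq_mul // ltnW.
have hcl := bounded_lift k hc.
apply: (bounded_mul M0); last by apply: hh => //; lia.
apply: (bounded_pow2 (c := 2) M0); last by rewrite leq_mul2l leq_subr.
apply: (bounded_mul M0 (bounded_const M0 (n := 2) _)).
apply: (bounded_sub M0 (bounded_mul M0 hcl hcl)).
by apply: (bounded_sub M0) vr; apply: hl.
Qed.

Theorem ee_time_computable_numer :
  ee_time_computable
    (fun s r u => (numer s r u)%:R / (2 ^ (2 * (cutoff s r * cutoff s r)))%:R)%R.
Proof.
have [j h] := bounded_numer.
apply: (@ee_time_computable_exprs DenomE NumerE
  (fun s r _ => 2 * (cutoff s r * cutoff s r)) numer (64 + j)) => s r u Ju B.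
have [h1 h2] := h s r u Ju.
have le : (2 ^ (cutoff s r * cutoff s r)) ^ j <= B.
  rewrite /B -expnM leq_exp2l // /cutoff -expnD.
  (* The square of the cutoff is [2^(8(s+r+7))], and [8(s+r+7) <= 56(s+r+1)]; the degree is absorbed
     by [j <= 2^j]. *)
  apply: leq_trans (_ : 2 ^ (56 * (s + r).+1) * 2 ^ j <= _).
    by rewrite leq_mul // ?leq_exp2l ?(ltnW (ltn_expl _ _)) //; lia.
  by rewrite -expnD leq_exp2l //; nia.
by split; apply: val_mono le; apply: bounded_val (leqnn j).
Qed.

(** * The martingale *)

(** A shorter dyadic interval inside [[u, u + 1) / 2^r] lies in exactly one of its halves. *)
Lemma meets_coarse m c r u : r < m ->
  meets m c r u = meets m c r.+1 (2 * u) + meets m c r.+1 (2 * u + 1).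
Proof.
move=> lt; rewrite /meets.
have [H ->] : exists H, 2 ^ m = 2 * 2 ^ r * H.
  by exists (2 ^ (m - r.+1)); rewrite -expnS -expnD; congr (2 ^ _); lia.
rewrite expnS; move: (2 ^ r) (expn_gt0 2 r) => q q0.
have E a b : (a * (2 * q) < b * (2 * q * H)) = (a < b * H).
  by rewrite (_ : b * (2 * q * H) = b * H * (2 * q)) ?ltn_pmul2r ?muln_gt0 //; lia.
have E' a b : (b * (2 * q * H) < a * (2 * q)) = (b * H < a).
  by rewrite (_ : b * (2 * q * H) = b * H * (2 * q)) ?ltn_pmul2r ?muln_gt0 //; lia.
have F a b : (a * q < b * (2 * q * H)) = (a < 2 * b * H).
  by rewrite (_ : b * (2 * q * H) = 2 * b * H * q) ?ltn_pmul2r //; lia.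
have F' a b : (b * (2 * q * H) < a * q) = (2 * b * H < a).
  by rewrite (_ : b * (2 * q * H) = 2 * b * H * q) ?ltn_pmul2r //; lia.
rewrite !E !E' F F'.
rewrite (_ : 2 * u.+1 * H = 2 * (u * H) + 2 * H); last by nia.
rewrite (_ : (2 * u).+1 * H = 2 * (u * H) + H); last by nia.
rewrite (_ : (2 * u + 1) * H = 2 * (u * H) + H); last by nia.
rewrite (_ : (2 * u + 1).+1 * H = 2 * (u * H) + 2 * H); last by nia.
rewrite (_ : 2 * u * H = 2 * (u * H)); last by nia.
by move: (u * H) => v; do 6 (case: ltnP => ?; try lia).
Qed.

(** A dyadic interval at least as long as [[u, u + 1) / 2^r] contains both of its halves or misses
    both. *)
Lemma meets_fine m c r u (b : bool) : m <= r ->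
  meets m c r.+1 (2 * u + b) = meets m c r u.
Proof.
move=> le; rewrite /meets expnS.
have [H ->] : exists H, 2 ^ r = H * 2 ^ m.
  by exists (2 ^ (r - m)); rewrite -expnD; congr (2 ^ _); lia.
move: (2 ^ m) (expn_gt0 2 m) => q q0.
rewrite !mulnA !ltn_pmul2r // !(mulnAC _ 2).
by congr (nat_of_bool _ * nat_of_bool _); case: b; nia.
Qed.

Lemma sum_bool2 (V : nmodType) (F : bool * bool -> V) :
  (\sum_(a : bool * bool) F a =
   F (true, true) + F (true, false) + (F (false, true) + F (false, false)))%R.
Proof.
have -> : (\sum_(a : bool * bool) F a = \sum_(a : bool) \sum_(b : bool) F (a, b))%R.
  by rewrite pair_bigA /=; apply: eq_bigr => -[].
by rewrite !big_bool.
Qed.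

Definition child (u : nat * nat) (a : bool * bool) : nat * nat :=
  (2 * u.1 + a.1, 2 * u.2 + a.2).

Lemma hits_coarse k r u : r < lvl k ->
  (\sum_(a : bool * bool) hits k r.+1 (child u a) = hits k r u)%R.
Proof.
move=> lt; rewrite sum_bool2 /hits /child /= -!big_split /=.
do 3 (apply: eq_bigr => ? _; rewrite -?big_split /=).
do 2 (apply: eq_bigr => ? _; rewrite -?big_split /=).
by rewrite /cell_meets !(meets_coarse _ _ lt) !addn0; lia.
Qed.

Lemma hits_fine k r u a : lvl k <= r -> hits k r.+1 (child u a) = hits k r u.
Proof.
move=> le; rewrite /hits /child /=.
by do 5 (apply: eq_bigr => ? _); rewrite /cell_meets !meets_fine.
Qed.

(** All terms are at most 1, and their number is [2 * 2 * 8 * 8] times [4^(k^2)]. *)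
Lemma hits_le k r u : hits k r u <= 256 * 4 ^ (k * k).
Proof.
rewrite /hits.
apply: leq_trans (_ : \sum_(0 <= g < 2) \sum_(0 <= A < 2 * 2 ^ (k * k))
  \sum_(0 <= w < 2 ^ (k * k)) \sum_(0 <= e1 < 8) \sum_(0 <= e2 < 8) 1 <= _).
  do 5 (apply: leq_sum => ? _).
  by rewrite /cell_meets /meets; do 4 case: (_ < _).
rewrite !sum_nat_const_nat !subn0 -[4]/(2 * 2) expnMn; lia.
Qed.

Local Open Scope classical_set_scope.
Local Open Scope ring_scope.

Lemma lev_eq k l : (16 ^ l <= k < 16 ^ l.+1)%N -> lev k = l.
Proof. by move=> h; apply: trunc_log_eq. Qed.

Lemma lev_succ k : (0 < k)%N ->
  lev k.+1 = lev k \/ k.+1 = (16 ^ (lev k).+1)%N /\ lev k.+1 = (lev k).+1.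
Proof.
move=> k0; have lo := lev_le k0; have hi := lev_gt k.
move: hi; rewrite leq_eqVlt => /orP[/eqP e|lt]; last first.
  by left; apply: lev_eq; rewrite lt andbT; apply: leqW.
by right; split=> //; apply: lev_eq; rewrite e leqnn ltn_exp2l ?ltnSn.
Qed.

(** * Summability and averaging of the densities *)

Section Martingale.
Variable R : realType.
Implicit Types (k n r : nat) (u : nat * nat).

(** The total relative density, in square [u] of level [r], of the squares of stage [k]. Truncated
    subtraction covers the levels [r >= lvl k], where each square met contains the given one and
    counts 1. *)
Definition stage k r u : R := 4^-1 ^+ (lvl k - r) * (hits k r u)%:R.
Definition psum n r u : R := \sum_(0 <= k < n) stage k r u.

(* [tail k] is the sum of [64^-lev j] over [j >= k], for [0 < k]: the 15 * 16^l
   indices of level [l] contribute 15 * 4^-l. *)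
Definition tail k : R :=
  20 * 4^-1 ^+ lev k - (k%:R - 16 ^+ lev k) * 64^-1 ^+ lev k.

Lemma exprV_mul (a b : R) l : a != 0 -> (a * b)^-1 ^+ l * a ^+ l = b^-1 ^+ l.
Proof. by move=> a0; rewrite -exprMn invfM mulrAC mulVf ?mul1r. Qed.

(** Inside a level only the linear term changes. Across the end of level [l] the identity is
    [15 * 4^-l = 20 * 4^-l - 20 * 4^-(l+1)], whence the constant 20. *)
Lemma tail_step k : (0 < k)%N -> tail k = 64^-1 ^+ lev k + tail k.+1.
Proof.
move=> k0; rewrite /tail; case: (lev_succ k0) => [->|[e ->]].
  by rewrite -natr1; ring.
have ek : (k.+1)%:R = 16 * 16 ^+ lev k :> R by rewrite e natrX exprS.
rewrite -natr1 in ek.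
have -> : k%:R = 16 * 16 ^+ lev k - 1 :> R by rewrite -ek; ring.
rewrite -[k.+1%:R]natr1 ek !exprS.
have e4 : 64^-1 ^+ lev k * 16 ^+ lev k = 4^-1 ^+ lev k :> R.
  by rewrite -[64]/(64%:R) (_ : 64 = 16 * 4)%N // natrM exprV_mul.
have -> : 20 * 4^-1 ^+ lev k - (16 * 16 ^+ lev k - 1 - 16 ^+ lev k) * 64^-1 ^+ lev k =
  20 * 4^-1 ^+ lev k - 15 * (64^-1 ^+ lev k * 16 ^+ lev k) + 64^-1 ^+ lev k :> R by ring.
by rewrite e4; field.
Qed.

Lemma tail_ge0 k : (0 < k)%N -> 0 <= tail k.
Proof.
move=> k0; rewrite /tail.
have e4 : 64^-1 ^+ lev k * 16 ^+ lev k = 4^-1 ^+ lev k :> R.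
  by rewrite -[64]/(64%:R) (_ : 64 = 16 * 4)%N // natrM exprV_mul.
have : k%:R <= 16 * 16 ^+ lev k :> R.
  by rewrite -exprS -natrX ler_nat ltnW // lev_gt.
have : 0 < 64^-1 ^+ lev k :> R by rewrite exprn_gt0 // invr_gt0.
have : 0 <= 16 ^+ lev k :> R by rewrite exprn_ge0.
rewrite -e4; move: (64^-1 ^+ _) (16 ^+ _) (k%:R) => x y z y0 x0 le.
have -> : 20 * (x * y) - (z - y) * x = x * (21 * y - z) by ring.
by apply: mulr_ge0; lra.
Qed.

Lemma stage_ge0 k r u : 0 <= stage k r u.
Proof. by rewrite mulr_ge0 // exprn_ge0 // invr_ge0. Qed.

(** The [4^(k^2)] choices of prefix and abscissa cancel against the area [4^-lvl k], which leaves
    [4^-wid k = 64^-lev k]. *)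
Lemma stage_le k r u : stage k r u <= 256 * 4 ^+ r * 64^-1 ^+ lev k.
Proof.
have le1 : (4^-1 : R) ^+ (lvl k - r) <= 4 ^+ r * 4^-1 ^+ lvl k.
  case: (leqP r (lvl k)) => le.
    by rewrite -{2}(subnKC le) exprD mulrA -exprMn divff // expr1n mul1r.
  rewrite (eqP (ltnW le : (_ - _ == 0)%N)) expr0 -(subnKC (ltnW le)) exprD.
  rewrite mulrAC -exprMn divff // expr1n mul1r.
  by rewrite exprn_ege1 // ler1n.
apply: le_trans (_ : 4 ^+ r * 4^-1 ^+ lvl k * (256 * 4 ^ (k * k))%:R <= _).
  by rewrite ler_pM // ?exprn_ge0 ?invr_ge0 // ler_nat hits_le.
rewrite natrM natrX /lvl exprD /wid (exprM _ 3).
have -> : (4^-1 : R) ^+ 3 = 64^-1 by field.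
have : (4^-1 : R) ^+ (k * k) * 4 ^+ (k * k) = 1 by rewrite -exprMn mulVf // expr1n.
move: (4^-1 ^+ _) (4 ^+ (k * k)) => x y e.
rewrite (_ : 4 ^+ r * (x * 64^-1 ^+ lev k) * (256 * y) =
  256 * 4 ^+ r * 64^-1 ^+ lev k * (x * y)); first by rewrite e mulr1.
move: (4 ^+ r) (64^-1 ^+ _) => a b; clear e; move: (x : R) => x'; ring.
Qed.

Lemma psum_tail I n r u : (0 < I)%N ->
  psum (I + n) r u <= psum I r u + 256 * 4 ^+ r * (tail I - tail (I + n)).
Proof.
move=> I0; elim: n => [|n IH]; first by rewrite addn0 subrr mulr0 addr0.
rewrite addnS /psum big_nat_recr //=.
have := stage_le (I + n) r u; have := @tail_step (I + n) (leq_trans I0 (leq_addr _ _)).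
move: IH; rewrite /psum => IH e; rewrite e in IH; lra.
Qed.

Lemma psum_nondecreasing r u : {homo (fun n => psum n r u) : n m / (n <= m)%N >-> n <= m}.
Proof.
apply: homo_leq => [n|n m p|n]; [exact: lexx | exact: le_trans | ].
by rewrite /psum big_nat_recr //= lerDl stage_ge0.
Qed.

Lemma psum_le I n r u : (0 < I)%N ->
  psum n r u <= psum I r u + 256 * 4 ^+ r * tail I.
Proof.
move=> I0; apply: le_trans (psum_nondecreasing r u (leq_addl I n)) _.
apply: le_trans (psum_tail n r u I0) _; rewrite lerD2l ler_pM2l; last first.
  by rewrite mulr_gt0 // exprn_gt0.
by rewrite gerBl tail_ge0 // addn_gt0 I0.
Qed.

Definition density r u : R := limn (fun n => psum n r u).

Lemma psum_cvg r u : cvgn (fun n => psum n r u).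
Proof.
apply: nondecreasing_is_cvgn; first exact: psum_nondecreasing.
by exists (psum 1 r u + 256 * 4 ^+ r * tail 1) => _ [n _ <-]; apply: psum_le.
Qed.

Lemma psum_le_density n r u : psum n r u <= density r u.
Proof. exact: nondecreasing_cvgn_le (@psum_nondecreasing r u) (@psum_cvg r u) n. Qed.

Lemma density_le I r u : (0 < I)%N ->
  density r u <= psum I r u + 256 * 4 ^+ r * tail I.
Proof.
move=> I0; apply: limr_le; first exact: psum_cvg.
by apply: nearW => n; apply: psum_le.
Qed.

Lemma density_ge0 r u : 0 <= density r u.
Proof.
by apply: le_trans (psum_le_density 0 r u); rewrite /psum big_geq.
Qed.

Lemma stage_average k r u :
  stage k r u = 4^-1 * \sum_(a : bool * bool) stage k r.+1 (child u a).
Proof.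
rewrite /stage; case: (ltnP r (lvl k)) => lt.
  rewrite -mulr_sumr -natr_sum hits_coarse // mulrA -exprS.
  by congr (_ ^+ _ * _); lia.
rewrite sum_bool2 !hits_fine // (_ : lvl k - r = 0)%N 1?(_ : lvl k - r.+1 = 0)%N; try lia.
by rewrite !expr0 !mul1r; move: (_%:R) => x; field.
Qed.

Lemma psum_average n r u :
  psum n r u = 4^-1 * \sum_(a : bool * bool) psum n r.+1 (child u a).
Proof.
rewrite /psum exchange_big /= mulr_sumr; apply: eq_bigr => k _.
exact: stage_average.
Qed.

Lemma density_average r u :
  density r u = 4^-1 * \sum_(a : bool * bool) density r.+1 (child u a).
Proof.
apply/cvg_lim => //; rewrite (_ : (fun n => psum n r u) =
  (fun n => 4^-1 * \sum_(a : bool * bool) psum n r.+1 (child u a))); last first.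
  by apply/funext => n; exact: psum_average.
rewrite sum_bool2; under eq_fun do rewrite sum_bool2.
apply: cvgM; first exact: cvg_cst.
by apply: cvgD; apply: cvgD; apply: psum_cvg.
Qed.

End Martingale.

(** With [I] the cutoff, [lvl k <= k^2 + k <= I^2] for [k < I], so [4^(I^2)] is a common denominator
    and the subtraction in [numer] is not truncated. *)
Lemma numerE (F : numFieldType) s r u :
  (numer s r u)%:R / (2 ^ (2 * (cutoff s r * cutoff s r)))%:R =
  \sum_(0 <= k < cutoff s r) 4^-1 ^+ (lvl k - r) * (hits k r u)%:R :> F.
Proof.
rewrite /numer natr_sum mulr_suml big_nat [RHS]big_nat; apply: eq_bigr => k /andP[_ lt].
set I := cutoff s r in lt *.
have le : (lvl k - r <= I * I)%N.
  by apply: leq_trans (leq_subr _ _) _; have := wid_le k; rewrite /lvl; nia.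
have -> : (2 ^ (2 * (I * I)) = 2 ^ (2 * (I * I - (lvl k - r))) * 4 ^ (lvl k - r))%N.
  by rewrite -[4%N]/(2 ^ 2)%N -expnM -expnD; congr (2 ^ _)%N; lia.
rewrite !natrM [(4 ^ _)%:R]natrX exprVn.
have x0 : (2 ^ (2 * (I * I - (lvl k - r))))%:R != 0 :> F by rewrite pnatr_eq0 -lt0n expn_gt0.
have y0 : (4 : F) ^+ (lvl k - r) != 0 by rewrite expf_neq0.
by move: (_%:R) (_ ^+ _) x0 y0 => x y x0 y0; field; rewrite x0 y0.
Qed.

(** * Dyadic cubes, the martingale on them and its success *)

Section Plane.
Variable R : realType.
Implicit Types (x : R * R) (r : nat) (u : nat * nat).

Lemma cube_corner r u : @cube R r u (u.1%:R / 2 ^+ r, u.2%:R / 2 ^+ r).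
Proof.
by split=> /=; rewrite lexx ltr_pM2r ?invr_gt0 ?exprn_gt0 // ltr_nat ltnSn.
Qed.

Lemma cube_index r u x : @cube R r u x ->
  u = (Num.truncn (x.1 * 2 ^+ r), Num.truncn (x.2 * 2 ^+ r)).
Proof.
have e0 : 0 < 2 ^+ r :> R by rewrite exprn_gt0.
case: u => a b [] /=; rewrite !ler_pdivrMr // !ltr_pdivlMr // => h1 h2.
by rewrite (truncn_def h1) (truncn_def h2).
Qed.

Lemma cube_truncn r x : unit_square x ->
  let u := (Num.truncn (x.1 * 2 ^+ r), Num.truncn (x.2 * 2 ^+ r)) in
  Defs.J r u /\ @cube R r u x.
Proof.
move=> [/andP[a0 a1] /andP[b0 b1]] u.
have e0 : 0 < 2 ^+ r :> R by rewrite exprn_gt0.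
have x0 : 0 <= x.1 * 2 ^+ r by rewrite mulr_ge0 // ltW.
have y0 : 0 <= x.2 * 2 ^+ r by rewrite mulr_ge0 // ltW.
split; split=> /=.
- by rewrite truncn_lt_nat // natrX gtr_pMl.
- by rewrite truncn_lt_nat // natrX gtr_pMl.
- by rewrite ler_pdivrMr // ltr_pdivlMr // truncn_itv.
- by rewrite ler_pdivrMr // ltr_pdivlMr // truncn_itv.
Qed.

Lemma cube_inj_level r r' u u' : @cube R r u = @cube R r' u' -> (r' <= r)%N.
Proof.
move=> e; rewrite leqNgt; apply/negP => lt.
have p : 0 < 2 ^+ r :> R by rewrite exprn_gt0.
have p' : 0 < 2 ^+ r' :> R by rewrite exprn_gt0.
have lo : u.1%:R / 2 ^+ r = u'.1%:R / 2 ^+ r' :> R.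
  have := cube_corner r' u'; rewrite -e => -[/andP[h1 _] _].
  have := cube_corner r u; rewrite e => -[/andP[h2 _] _].
  by apply: le_anti; rewrite h1 h2.
have w : (2 ^+ r')^-1 < (2 ^+ r)^-1 :> R by rewrite ltf_pV2 // ltr_eXn2l // ltr1n.
(* The cubes share their left edge; a point one smaller side to the right of it is only in the
   larger cube. *)
have : @cube R r u (u'.1%:R / 2 ^+ r' + (2 ^+ r')^-1, u.2%:R / 2 ^+ r).
  split; last by have [] := cube_corner r u.
  rewrite /= -lo lerDl invr_ge0 ltW //= -[u.1.+1%:R]natr1 mulrDl mul1r; lra.
rewrite e => -[/andP[_] /=]; rewrite -[u'.1.+1%:R]natr1 mulrDl mul1r ltxx //.
Qed.

Lemma cube_inj r r' u u' : @cube R r u = @cube R r' u' -> r = r' /\ u = u'.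
Proof.
move=> e; have er : r = r'.
  by apply/eqP; rewrite eqn_leq (cube_inj_level e) (cube_inj_level (esym e)).
split=> //; have := cube_corner r u; rewrite e => /cube_index ->.
by rewrite er in e *; rewrite -(cube_index (cube_corner r' u)).
Qed.

(** A martingale takes sets as arguments, so level and index are recovered from the set; [cube_inj]
    makes this unambiguous. *)
Definition cube_code (Q : set (R * R)) : nat * (nat * nat) :=
  xget (0%N, (0%N, 0%N)) [set p | @cube R p.1 p.2 = Q].

Definition kakeya_martingale (Q : set (R * R)) : R :=
  density R (cube_code Q).1 (cube_code Q).2.

Lemma kakeya_martingale_cube r u : kakeya_martingale (@cube R r u) = density R r u.
Proof.
rewrite /kakeya_martingale /cube_code (@xget_unique _ _ _ (r, u)) // => -[r' u'] /=.
by move=> /cube_inj[-> ->].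
Qed.

Lemma kakeya_martingaleP : martingale kakeya_martingale.
Proof.
split=> [r Q [u _ <-]|r u _]; first by rewrite kakeya_martingale_cube density_ge0.
rewrite kakeya_martingale_cube density_average; congr (_ * _).
by apply: eq_bigr => a _; rewrite kakeya_martingale_cube.
Qed.

Lemma lev_cutoff s r : lev (cutoff s r) = (s + r + 7)%N.
Proof.
by apply: lev_eq; rewrite /cutoff expnM -[(2 ^ 4)%N]/16%N leqnn ltn_exp2l ?ltnSn.
Qed.

Lemma kakeya_martingale_computable : ee_computable kakeya_martingale.
Proof.
exists (fun s r u => (numer s r u)%:R / (2 ^ (2 * (cutoff s r * cutoff s r)))%:R).
split; first exact: ee_time_computable_numer.
split=> [s r u _|s r u _]; first by rewrite divr_ge0.
rewrite rmorphM fmorphV !rmorph_nat numerE kakeya_martingale_cube.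
rewrite -[X in `|X - _|]/(psum R (cutoff s r) r u).
have c0 : (0 < cutoff s r)%N by rewrite expn_gt0.
rewrite distrC ger0_norm ?subr_ge0 ?psum_le_density // lerBlDl.
apply: le_trans (density_le R r u c0) _; rewrite lerD2l /tail lev_cutoff.
have -> : (cutoff s r)%:R = 16 ^+ (s + r + 7) :> R.
  by rewrite /cutoff expnM natrX.
rewrite subrr mul0r subr0 !exprD.
have e4 : 4 ^+ r * 4^-1 ^+ r = 1 :> R by rewrite -exprMn divff // expr1n.
have -> : 256 * 4 ^+ r * (20 * (4^-1 ^+ s * 4^-1 ^+ r * 4^-1 ^+ 7)) =
  4 ^+ r * 4^-1 ^+ r * (4^-1 ^+ s * (256 * 20 * 4^-1 ^+ 7)) :> R.
  by move: (4^-1 ^+ 7) (4^-1 ^+ r) (4^-1 ^+ s) (4 ^+ r) => a b c d; ring.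
rewrite e4 mul1r -exprVn.
(* Here [256 * 20 = 5120 <= 4^7], the reason for the 7 in [cutoff]. *)
apply: le_trans (_ : 4^-1 ^+ s * 1 <= _).
  by rewrite ler_wpM2l ?exprn_ge0 ?invr_ge0 // !exprS expr0; lra.
by rewrite mulr1 lerXn2r ?nnegrE ?invr_ge0 // lef_pV2 ?posrE // ler_nat.
Qed.

Lemma value_atE r u x : @cubes R r (@cube R r u) -> @cube R r u x ->
  value_at kakeya_martingale r x = density R r u.
Proof.
move=> cu xu; rewrite /value_at (@xget_unique _ _ _ (@cube R r u)).
- exact: kakeya_martingale_cube.
- by [].
- by move=> Q [[u' _ <-] xu']; rewrite (cube_index xu') (cube_index xu).
Qed.

(* [x] lies in one of the cubes counted by [hits k]. *)
Definition hit_at k x := exists g A w e1 e2, [/\ (g < 2)%N,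
  (A < 2 * 2 ^ (k * k))%N, (w < 2 ^ (k * k))%N, (e1 < 8)%N & (e2 < 8)%N] /\
  ((coord1 g A w k e1 %% 2 ^ lvl k)%N%:R <= x.1 * 2 ^+ lvl k
     < (coord1 g A w k e1 %% 2 ^ lvl k).+1%:R) /\
  ((coord2 A w k e2 %% 2 ^ lvl k)%N%:R <= x.2 * 2 ^+ lvl k
     < (coord2 A w k e2 %% 2 ^ lvl k).+1%:R).

Lemma meets_common m c r (u : nat) (z : R) :
  c%:R <= z * 2 ^+ m < c.+1%:R -> u%:R <= z * 2 ^+ r < u.+1%:R ->
  meets m c r u = 1%N.
Proof.
move=> /andP[c1 c2] /andP[u1 u2]; rewrite /meets.
have pm : 0 < 2 ^+ m :> R by rewrite exprn_gt0.
have pr : 0 < 2 ^+ r :> R by rewrite exprn_gt0.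
have -> : (c * 2 ^ r < u.+1 * 2 ^ m)%N.
  rewrite -(ltr_nat R) !natrM !natrX; apply: le_lt_trans (_ : z * 2 ^+ m * 2 ^+ r < _).
    by rewrite ler_pM2r.
  by rewrite mulrAC ltr_pM2r.
have -> // : (u * 2 ^ m < c.+1 * 2 ^ r)%N.
rewrite -(ltr_nat R) !natrM !natrX; apply: le_lt_trans (_ : z * 2 ^+ r * 2 ^+ m < _).
  by rewrite ler_pM2r.
by rewrite mulrAC ltr_pM2r.
Qed.

Lemma sum_ge (n i : nat) (F : nat -> nat) : (i < n)%N ->
  (F i <= \sum_(0 <= j < n) F j)%N.
Proof.
by move=> lt; rewrite big_mkord (bigD1 (Ordinal lt)) //= leq_addr.
Qed.

Lemma hits_gt0 k r u x : hit_at k x -> @cube R r u x -> (0 < hits k r u)%N.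
Proof.
move=> [g [A [w [e1 [e2 [[lg lA lw l1 l2] [h1 h2]]]]]]] [].
have pr : 0 < 2 ^+ r :> R by rewrite exprn_gt0.
rewrite !ler_pdivrMr // !ltr_pdivlMr // => u1 u2.
rewrite /hits.
apply: leq_trans (sum_ge _ lg); apply: leq_trans (sum_ge _ lA).
apply: leq_trans (sum_ge _ lw); apply: leq_trans (sum_ge _ l1).
apply: leq_trans (sum_ge _ l2).
by rewrite /cell_meets (meets_common h1 u1) (meets_common h2 u2).
Qed.

Lemma hit_succeeds x : unit_square x ->
  (forall N : nat, exists k, (N <= k)%N /\ hit_at k x) ->
  succeeds kakeya_martingale x.
Proof.
move=> xU hx; pose u r := (Num.truncn (x.1 * 2 ^+ r), Num.truncn (x.2 * 2 ^+ r)).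
have uP r : Defs.J r (u r) /\ @cube R r (u r) x := cube_truncn r xU.
have vE r : value_at kakeya_martingale r x = density R r (u r).
  by have [uJ uC] := uP r; apply: value_atE => //; exists (u r).
(* Each stage that hits [x] contributes at least 1 at all levels from [lvl k] on, so [c] such stages
   give [c]. The values thus tend to infinity, not just their upper limit. *)
have grow c : exists n r0, forall r, (r0 <= r)%N -> c%:R <= psum R n r (u r).
  elim: c => [|c [n [r0 IH]]].
    by exists 0%N, 0%N => r _; rewrite /psum big_geq.
  have [k [le hk]] := hx n; exists k.+1, (maxn r0 (lvl k)) => r.
  rewrite geq_max => /andP[le0 lek]; rewrite /psum big_nat_recr //= -natr1 lerD //.
    exact: le_trans (IH r le0) (@psum_nondecreasing R r (u r) n k le).
  rewrite /stage (eqP lek) expr0 mul1r ler1n.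
  by apply: hits_gt0 hk _; case: (uP r).
rewrite /succeeds; under eq_fun do rewrite vE.
have : (fun r => (density R r (u r))%:E) @ \oo --> +oo%E.
  apply/cvgeryP/cvgryPge => a.
  have [n [r0 h]] := grow (Num.truncn a).+1; exists r0 => // r /= le.
  apply: le_trans (le_trans (h r le) (psum_le_density _ _ _ _)).
  exact/ltW/truncnS_gt.
by move=> /cvg_limn_einf_sup[].
Qed.

End Plane.

(** * The lines *)

Section Kakeya.
Variable R : realType.
Implicit Types (a t z : R) (k n i m : nat).

Lemma pow2_gt0 n : 0 < 2 ^+ n :> R. Proof. by rewrite exprn_gt0. Qed.

(** Reduction of the cell modulo [2 ^ m] is translation of the point by an integer; [q] compensates
    for [X] being computed without negative numbers. *)
Lemma frac_cell m (X : nat) (q : int) z :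
  X%:R <= z * 2 ^+ m - q%:~R * 2 ^+ m < X.+1%:R ->
  (X %% 2 ^ m)%N%:R <= (z + (- Num.floor z)%:~R) * 2 ^+ m < (X %% 2 ^ m)%N.+1%:R.
Proof.
move=> h; have p := pow2_gt0 m.
have P0 : (0 < 2 ^ m)%N by rewrite expn_gt0.
have eX := divn_eq X (2 ^ m); have lt := ltn_pmod X P0.
set Q := (X %/ 2 ^ m)%N in eX; set c := (X %% 2 ^ m)%N in eX lt *.
have eR : X%:R = Q%:R * 2 ^+ m + c%:R :> R by rewrite eX natrD natrM natrX.
have ltR : c.+1%:R <= 2 ^+ m :> R by rewrite -natrX ler_nat.
have -> : Num.floor z = q + Q%:Z.
  apply: floor_def; rewrite !intrD /= -pmulrn; apply/andP.
  move: h; rewrite -[X.+1%:R]natr1 eR; rewrite -natr1 in ltR; move=> /andP[h1 h2].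
  have c0 : 0 <= c%:R :> R by [].
  by split; [rewrite -(ler_pM2r p) | rewrite -(ltr_pM2r p)]; lra.
rewrite opprD intrD !mulrNz -pmulrn; move: h; rewrite -[X.+1%:R]natr1 -[c.+1%:R]natr1 eR.
by move=> /andP[h1 h2]; apply/andP; split; lra.
Qed.

Lemma frac_hit m (X : nat) (q : int) z :
  0 <= z * 2 ^+ m - q%:~R * 2 ^+ m - X%:R < 8 ->
  exists e, (e < 8)%N /\
  ((X + e) %% 2 ^ m)%N%:R <= (z + (- Num.floor z)%:~R) * 2 ^+ m
    < ((X + e) %% 2 ^ m)%N.+1%:R.
Proof.
set y := _ - X%:R => /andP[y0 y8]; exists (Num.truncn y).
split; first by rewrite truncn_lt_nat.
apply: (@frac_cell m _ q); have /andP[h1 h2] := truncn_itv y0.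
by rewrite -addnS !natrD; apply/andP; split; rewrite /y in h1 h2 *; lra.
Qed.

Lemma truncn_divn z (d : nat) : 0 <= z -> (0 < d)%N ->
  (Num.truncn z %/ d)%N = Num.truncn (z / d%:R).
Proof.
move=> z0 d0; have dR : 0 < d%:R :> R by rewrite ltr0n.
apply/esym/truncn_def; have /andP[h1 h2] := truncn_itv z0.
rewrite ler_pdivlMr // ltr_pdivrMr // -!natrM; apply/andP; split.
  by apply: le_trans h1; rewrite ler_nat leq_trunc_div.
by apply: lt_le_trans h2 _; rewrite ler_nat ltn_ceil.
Qed.

Definition dig a i := (Num.truncn (a * 2 ^+ (i.+1 * i.+1)) %% 2 ^ (2 * i).+1)%N.

Lemma digit_truncn a k i : 0 <= a -> (i < k)%N ->
  digit (Num.truncn (a * 2 ^+ (k * k))) k i = dig a i.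
Proof.
move=> a0 lt; rewrite /digit truncn_divn ?expn_gt0 //; last first.
  by rewrite mulr_ge0 // ltW // pow2_gt0.
congr (Num.truncn _ %% _)%N; rewrite -mulrA; congr (_ * _).
have le : (i.+1 * i.+1 <= k * k)%N by rewrite leq_mul.
rewrite -{1}(subnK le) exprD natrX mulrAC divff ?mul1r //. 
Qed.

(** This is [a_i x_i 2^(-(i+1)^2)]; their sum [beta a] gives the line in the form
    [y_a t = a t - beta a]. *)
Definition summand a i : R := (dig a i * num i)%N%:R / 2 ^+ (i.+1 * i.+1 + wid i).
Definition betan a n : R := \sum_(0 <= i < n) summand a i.

Lemma summand_ge0 a i : 0 <= summand a i.
Proof. by rewrite divr_ge0 // ltW // pow2_gt0. Qed.

Lemma wid_mono i k : (i <= k)%N -> (wid i <= wid k)%N.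
Proof. by move=> le; rewrite leq_mul2l /= /lev leq_trunc_log. Qed.

(** No rounding occurs: for [i < k], the denominator exponent [(i+1)^2 + wid i] is at most
    [lvl k]. *)
Lemma betan_offset a k : 0 <= a ->
  betan a k * 2 ^+ lvl k = (offset (Num.truncn (a * 2 ^+ (k * k))) k)%:R.
Proof.
move=> a0; rewrite /betan /offset mulr_suml natr_sum.
apply: eq_big_nat => i /andP[_ lt]; rewrite digit_truncn // /summand.
have le : (i.+1 * i.+1 + wid i <= lvl k)%N.
  by apply: leq_add; [exact: leq_mul | exact: (wid_mono (ltnW lt))].
rewrite -{1}(subnKC le) [2 ^+ (_ + (lvl k - _))]exprD [RHS]natrM natrX mulrA divfK //.
Qed.

(** The exponent is [(n+2)^2 - (2n+3) - (n+1)], for the denominator, the block and [num]. *)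
Lemma summand_le a n : summand a n.+1 <= 2^-1 ^+ (n * n.+1).
Proof.
rewrite /summand ler_pdivrMr ?pow2_gt0 // -natrX.
have h1 : (dig a n.+1 < 2 ^ (2 * n.+1).+1)%N by rewrite ltn_pmod // expn_gt0.
have h2 : (num n.+1 <= 2 ^ n.+1)%N.
  by apply: leq_trans (leq_subr _ _) (ltnW (ltn_expl _ _)).
apply: le_trans (_ : (2 ^ (2 * n.+1).+1 * 2 ^ n.+1)%N%:R <= _).
  by rewrite ler_nat leq_mul // ltnW.
rewrite -expnD !natrX exprVn mulrC ler_pdivlMr ?pow2_gt0 // -exprD.
by rewrite ler_eXn2l ?ltr1n //; lia.
Qed.

(** A nonincreasing sequence above all partial sums: it gives both convergence and the estimate of
    the remainder. *)
Definition upper a n : R := betan a n.+1 + 2 * 2^-1 ^+ (n * n.+1).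

Lemma upper_nonincreasing a n k : (n <= k)%N -> upper a k <= upper a n.
Proof.
move=> /subnK <-; elim: (k - n)%N => [|d IH]; first by rewrite lexx.
apply: le_trans IH; rewrite addSn; set j := (d + n)%N.
rewrite /upper {1}/betan big_nat_recr //= -/(betan a j.+1) -addrA lerD2l.
have := summand_le a j; rewrite (_ : j.+1 * j.+2 = j * j.+1 + 2 * j.+1)%N; last by lia.
rewrite exprD; set x := 2^-1 ^+ _; set y := 2^-1 ^+ (2 * _).
have x0 : 0 <= x by rewrite exprn_ge0 // invr_ge0.
have y1 : y <= 4^-1.
  rewrite /y exprM (_ : 2^-1 ^+ 2 = 4^-1 :> R); last by field.
  by rewrite exprS ler_piMr ?invr_ge0 // exprn_ile1 ?invr_ge0 // invf_le1 // ler1n.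
move: x y x0 y1 (summand a j.+1); clear => x y x0 y1 s h.
have : (x : R) * y <= x * 4^-1 by rewrite ler_wpM2l.
by move: (x : R) h x0 => {}x; lra.
Qed.

Lemma betan_nondecreasing a : {homo betan a : n m / (n <= m)%N >-> n <= m}.
Proof.
apply: homo_leq => [n|n m p|n]; [exact: lexx | exact: le_trans | ].
by rewrite /betan big_nat_recr //= lerDl summand_ge0.
Qed.

Lemma betan_le_upper a n k : betan a n <= upper a k.
Proof.
apply: le_trans (betan_nondecreasing a (leq_trans (leq_addr k n) (leqnSn _))) _.
apply: le_trans (upper_nonincreasing a (leq_addl n k)).
by rewrite lerDl mulr_ge0 // exprn_ge0 // invr_ge0.
Qed.

Definition beta a : R := limn (betan a).

Lemma betan_cvg a : cvgn (betan a).
Proof.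
apply: nondecreasing_is_cvgn; first exact: betan_nondecreasing.
by exists (upper a 0) => _ [n _ <-]; apply: betan_le_upper.
Qed.

Lemma betan_le_beta a n : betan a n <= beta a.
Proof. exact: nondecreasing_cvgn_le (@betan_nondecreasing a) (@betan_cvg a) n. Qed.

Lemma beta_le_upper a n : beta a <= upper a n.
Proof.
apply: limr_le; first exact: betan_cvg.
by apply: nearW => k; apply: betan_le_upper.
Qed.

Lemma wid_lt k : (0 < k)%N -> (wid k < k)%N.
Proof.
move=> k0; have := lev_le k0; rewrite /wid; case: (lev k) => [|l]; first by lia.
have : (3 * l.+1 < 16 ^ l.+1)%N.
  by elim: l => // l IH; rewrite expnS; lia.
by apply: leq_trans.
Qed.

End Kakeya.

Section Kakeya.
Variable R : realType.
Implicit Types (a t z : R) (k n i m : nat).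

(** The blocks after [k] shift the line by at most one unit [2^-lvl k]: the bound is
    [2^(1 - k + wid k)], and [wid k < k]. *)
Lemma beta_remainder a k : (0 < k)%N ->
  0 <= (beta a - betan a k.+1) * 2 ^+ lvl k <= 1.
Proof.
move=> k0; have p := pow2_gt0 R (lvl k).
have h1 := betan_le_beta a k.+1; have h2 := beta_le_upper a k.
apply/andP; split; first by rewrite mulr_ge0 ?subr_ge0 // ltW.
apply: le_trans (_ : 2 * 2^-1 ^+ (k * k.+1) * 2 ^+ lvl k <= _).
  by rewrite ler_pM2r // lerBlDl.
rewrite exprVn mulrAC -exprS ler_pdivrMr ?pow2_gt0 // mul1r.
by rewrite ler_eXn2l ?ltr1n // /lvl; have := wid_lt k0; lia.
Qed.

(** This is why block [k] does not matter at [x_k]. In units [2^-lvl k], the digits after place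
    [k^2] contribute [f * num k] to [a x_k]; subtracting the summand of block [k] leaves the digits
    after place [(k+1)^2], that is, less than 1 times [num k / 2^(2k+1) <= 1]. *)
Lemma summand_tail a k (A : nat) (f : R) : (0 < k)%N -> 0 <= f < 1 ->
  a * 2 ^+ (k * k) = A%:R + f ->
  0 <= f * (num k)%:R - summand a k * 2 ^+ lvl k <= 1.
Proof.
move=> k0 /andP[f0 f1] ea; have p := pow2_gt0 R (2 * k).+1.
have ef : a * 2 ^+ (k.+1 * k.+1) = (A * 2 ^ (2 * k).+1)%N%:R + f * 2 ^+ (2 * k).+1.
  rewrite (_ : k.+1 * k.+1 = k * k + (2 * k).+1)%N; last by lia.
  by rewrite exprD mulrA ea mulrDl natrM natrX.
have fp0 : 0 <= f * 2 ^+ (2 * k).+1 by rewrite mulr_ge0 // ltW.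
have fp1 : f * 2 ^+ (2 * k).+1 < (2 ^ (2 * k).+1)%N%:R by rewrite natrX gtr_pMl.
have /andP[t1 t2] := truncn_itv fp0; set F := Num.truncn _ in t1 t2.
have ed : dig a k = F.
  rewrite /dig ef; set P := (2 ^ (2 * k).+1)%N in fp1 *.
  have -> : Num.truncn ((A * P)%N%:R + f * 2 ^+ (2 * k).+1) = (A * P + F)%N.
    by apply: truncn_def; rewrite -addnS !natrD lerD2l ltrD2l t1 t2.
  by rewrite modnMDl modn_small // /F truncn_lt_nat.
rewrite /summand ed natrM.
have -> : lvl k = (k * k + wid k)%N by [].
rewrite (_ : k.+1 * k.+1 + wid k = (2 * k).+1 + (k * k + wid k))%N; last by lia.
rewrite exprD; have q := pow2_gt0 R (k * k + wid k).
have -> : F%:R * (num k)%:R / (2 ^+ (2 * k).+1 * 2 ^+ (k * k + wid k)) * 2 ^+ (k * k + wid k)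
   = F%:R * (num k)%:R / 2 ^+ (2 * k).+1 :> R.
  by rewrite invfM mulrA divfK // gt_eqF.
have hn : (num k)%:R <= 2 ^+ (2 * k).+1 :> R.
  rewrite -natrX ler_nat; apply: leq_trans (leq_subr _ _) _.
  by apply: leq_trans (ltnW (ltn_expl k (isT : 1 < 2)%N)) _; rewrite leq_exp2l //; lia.
have n0 : 0 <= (num k)%:R :> R by [].
rewrite -[F.+1%:R]natr1 in t2.
have -> : f * (num k)%:R - F%:R * (num k)%:R / 2 ^+ (2 * k).+1 =
   (f * 2 ^+ (2 * k).+1 - F%:R) * (num k)%:R / 2 ^+ (2 * k).+1.
  by field; rewrite gt_eqF.
apply/andP; split; first by rewrite divr_ge0 ?mulr_ge0 ?subr_ge0 // ltW.
rewrite ler_pdivrMr // mul1r; apply: le_trans hn.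
by rewrite ler_piMl // lerBlDl ltW.
Qed.

(** Up to small errors, the position depends only on [A], [w] and [k]: rounding contributes an error
    in [0, 3), [summand_tail] one in [0, 1], and [beta_remainder] one in [0, 1] with a minus
    sign. *)
Lemma strip a t k (w : nat) (theta : R) : 0 <= a <= 1 -> (0 < k)%N ->
  (w < 2 ^ (k * k))%N -> 0 <= theta < 1 ->
  t * 2 ^+ lvl k = (num k * 2 ^ (k * k) + w)%N%:R + theta ->
  let A := Num.truncn (a * 2 ^+ (k * k)) in
  -1 <= (a * t - beta a) * 2 ^+ lvl k -
        ((A * num k + A * w %/ 2 ^ (k * k))%N%:R - (offset A k)%:R) < 4.
Proof.
move=> /andP[a0 a1] k0 ltw /andP[th0 th1] et /=.
set A := Num.truncn _.
have p := pow2_gt0 R (k * k); set P := 2 ^+ (k * k) in p *.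
have eP : (2 ^ (k * k))%N%:R = P :> R by rewrite natrX.
have /andP[A1 A2] : A%:R <= a * P < A.+1%:R by apply: truncn_itv; rewrite mulr_ge0 // ltW.
rewrite -[A.+1%:R]natr1 in A2.
pose f := a * P - A%:R.
have f01 : 0 <= f < 1 by rewrite /f; apply/andP; split; lra.
have ef : a * P = A%:R + f by rewrite /f addrC subrK.
have /andP[s0 s1] := summand_tail k0 f01 ef.
have /andP[r0 r1] := beta_remainder a k0.
have eb : betan a k * 2 ^+ lvl k = (offset A k)%:R by apply: betan_offset.
have ebS : betan a k.+1 = betan a k + summand a k by rewrite /betan big_nat_recr.
have eaw : (A * w)%N%:R = (A * w %/ 2 ^ (k * k))%N%:R * P + (A * w %% 2 ^ (k * k))%N%:R :> R.
  by rewrite {1}(divn_eq (A * w) (2 ^ (k * k))) natrD natrM eP.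
set d := (A * w %/ _)%N in eaw *; set q := (A * w %% _)%N in eaw.
have q1 : q%:R < P by rewrite -eP ltr_nat ltn_pmod // expn_gt0.
have q0 : 0 <= q%:R :> R by [].
have AP : A%:R <= P.
  by apply: le_trans A1 _; rewrite ler_piMl // ltW.
have w1 : w%:R + theta <= P.
  have : w.+1%:R <= P by rewrite -eP ler_nat.
  by rewrite -[w.+1%:R]natr1; lra.
have w0 : 0 <= w%:R :> R by [].
(* Product of [a = (A + f) / P] and [num k * P + w + theta], with [A * w] divided by [P]. *)
have expand : a * t * 2 ^+ lvl k = A%:R * (num k)%:R + f * (num k)%:R + d%:R +
    (q%:R + A%:R * theta + f * (w%:R + theta)) / P.
  rewrite -mulrA et natrD natrM eP.
  have -> : a = (A%:R + f) / P by rewrite /f addrC subrK mulfK ?gt_eqF.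
  have -> : q%:R = A%:R * w%:R - d%:R * P :> R by rewrite natrM in eaw; rewrite eaw; ring.
  by field; rewrite gt_eqF.
have A0 : 0 <= A%:R :> R by [].
case/andP: (f01) => f0 f1.
have x0 : 0 <= (q%:R + A%:R * theta + f * (w%:R + theta)) / P.
  apply: divr_ge0; last exact: ltW.
  by rewrite !addr_ge0 // mulr_ge0 // addr_ge0.
have x3 : (q%:R + A%:R * theta + f * (w%:R + theta)) / P < 3.
  rewrite ltr_pdivrMr //.
  have h1 : A%:R * theta <= P * 1 by apply: ler_pM => //; exact: ltW.
  have h2 : f * (w%:R + theta) <= 1 * P.
    by apply: ler_pM => //; [exact: addr_ge0 | exact: ltW].
  by move: h1 h2 q1; clear; move: (A%:R * theta) (f * _) (q%:R) => x y z; lra.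
rewrite mulrBl expand natrD natrM.
move: r0 r1 s0 s1; rewrite ebS mulrBl mulrDl eb.
move: (_ / P) x0 x3 (beta a * _) (summand a k * _) (f * _) (A%:R * _) => x x0 x3 b s fN AN r0 r1 s0 s1.
by apply/andP; split; lra.
Qed.

(** At any level [l] with [t < 2^l], the index [k = 16^l + j] for [j] the integer part of [8^l t] is
    available, and [x_k] is [t] rounded down to a multiple of [8^-l]. *)
Lemma cover t n : 0 <= t -> exists k w theta, [/\ (n <= k)%N, (0 < k)%N,
  (w < 2 ^ (k * k))%N, 0 <= theta < 1 &
  t * 2 ^+ lvl k = (num k * 2 ^ (k * k) + w)%N%:R + theta].
Proof.
move=> t0; pose l := (n + (Num.truncn t).+1)%N; pose j := Num.truncn (t * 8 ^+ l).
have tl : t < 2 ^+ l.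
  apply: lt_trans (truncnS_gt t) _; rewrite -natrX ltr_nat.
  by apply: leq_ltn_trans (ltn_expl l (isT : 1 < 2)%N); rewrite leq_addl.
have t80 : 0 <= t * 8 ^+ l by rewrite mulr_ge0 // exprn_ge0.
have lj : (j < 16 ^ l)%N.
  rewrite truncn_lt_nat // natrX (_ : 16 = 2 * 8); last by lra.
  by rewrite exprMn ltr_pM2r // exprn_gt0.
have l16 : (l < 16 ^ l)%N by apply: ltn_expl.
pose k := (16 ^ l + j)%N.
have lk : lev k = l.
  by apply: lev_eq; rewrite leq_addr /= expnS /k; lia.
have nk : num k = j by rewrite /num lk expnM -[(2 ^ 4)%N]/16%N addKn.
have k0 : (0 < k)%N by rewrite addn_gt0 expn_gt0.
have tm0 : 0 <= t * 2 ^+ lvl k by rewrite mulr_ge0 // exprn_ge0.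
pose T := Num.truncn (t * 2 ^+ lvl k).
exists k, (T %% 2 ^ (k * k))%N, (t * 2 ^+ lvl k - T%:R); split=> //.
- by rewrite /k; apply: leq_trans (leq_addr _ _); apply: leq_trans (ltnW l16); rewrite leq_addr.
- by rewrite ltn_pmod // expn_gt0.
- have /andP[h1 h2] := truncn_itv tm0; rewrite -[(Num.truncn _).+1%:R]natr1 in h2.
  by apply/andP; split; rewrite /T; lra.
- have <- : T = (num k * 2 ^ (k * k) + T %% 2 ^ (k * k))%N.
    rewrite {1}(divn_eq T (2 ^ (k * k))); congr (_ * _ + _)%N.
    rewrite /T truncn_divn ?expn_gt0 // nk /j /lvl exprD natrX /wid lk (exprM _ 3).
    rewrite (_ : 2 ^+ 3 = 8 :> R); last by rewrite !exprS expr0; ring.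
    by congr Num.truncn; rewrite mulrCA mulrC mulKf // expf_neq0.
  by rewrite addrC subrK.
Qed.

Definition line_point (g : nat) a t : R * R :=
  ((-1) ^+ g * (a * t - beta a), t - (a * t - beta a)).

Lemma line_point_hit (g : nat) a t n : (g < 2)%N -> 0 <= a <= 1 -> 0 <= t ->
  exists k, (n <= k)%N /\ hit_at k (to_unit_square (line_point g a t)).
Proof.
move=> ltg a01 t0; have [k [w [theta [nk k0 ltw th01 et]]]] := cover n t0.
exists k; split=> //.
have /= := strip a01 k0 ltw th01 et.
set A := Num.truncn _; set Y := (A * num k + _)%N; set b := offset A k => hs.
have /andP[a0 a1] := a01.
(* The slope 1 has prefix [2^(k^2)], hence the factor 2 in the range of [A]. *)
have ltA : (A < 2 * 2 ^ (k * k))%N.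
  rewrite truncn_lt_nat ?mulr_ge0 ?exprn_ge0 // natrM natrX ltr_pM2r ?exprn_gt0 //.
  lra.
pose h := height A w k; pose P : R := 2 ^+ lvl k.
have P1 : (1 < 2 ^ lvl k)%N by rewrite -[1%N]/(2 ^ 0)%N ltn_exp2l // addn_gt0 muln_gt0 k0.
have oppE : (opp k)%:R = P - 1 by rewrite natrB 1?ltnW // natrX.
have opp1 : (1 + (opp k - 1) = opp k)%N by rewrite /opp; lia.
have hE : h%:R = Y%:R + (P - 1) * b%:R by rewrite /h /height -/b -/Y natrD natrM oppE.
have eh : height A w k = h by [].
clearbody h Y.
have hit1 : exists e, (e < 8)%N /\
    ((coord1 g A w k e %% 2 ^ lvl k)%N%:R <= (to_unit_square (line_point g a t)).1 * P
       < (coord1 g A w k e %% 2 ^ lvl k)%N.+1%:R).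
  have [e [lte he]] : exists e, (e < 8)%N /\
    (((1 + g * (opp k - 1)) * h + 4 * opp k + e) %% 2 ^ lvl k)%N%:R
     <= (to_unit_square (line_point g a t)).1 * P
     < (((1 + g * (opp k - 1)) * h + 4 * opp k + e) %% 2 ^ lvl k)%N.+1%:R.
    case: g ltg => [|[|//]] _.
      (* Since [opp k = P - 1], one has [h = Y - b + b P] and [4 * opp k = 4 P - 4]; the integer [q]
         removes these multiples of [P]. The error in [-1, 4) plus 4 falls into [3, 8); for the
         opposite sign it falls into (0, 5], and for the second coordinate into (0, 6). *)
      apply: (@frac_hit R _ _ (- (b + 4)%N%:Z)).
      rewrite mulrNz -pmulrn mul0n addn0 mul1n /= expr0 mul1r.
      rewrite (natrD _ h (4 * opp k)) (natrM _ 4 (opp k)) (natrD _ b 4) oppE hE.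
      by rewrite -/P; move: hs; rewrite -/P; move: (_ * P) => y /andP[h1 h2]; apply/andP; split; lra.
    apply: (@frac_hit R _ _ (b%:Z - (h + 4)%N%:Z)).
    rewrite intrB -!pmulrn mul1n opp1 /= expr1.
    rewrite (natrD _ (opp k * h) (4 * opp k)) (natrM _ 4 (opp k)) (natrM _ (opp k) h).
    rewrite (natrD _ h 4) oppE hE.
    rewrite -/P; move: hs; rewrite -/P mulN1r mulNr; move: (_ * P) => y /andP[h1 h2].
    by apply/andP; split; lra.
  by exists e; split=> //; rewrite /coord1 eh addnA.
have hit2 : exists e, (e < 8)%N /\
    ((coord2 A w k e %% 2 ^ lvl k)%N%:R <= (to_unit_square (line_point g a t)).2 * P
       < (coord2 A w k e %% 2 ^ lvl k)%N.+1%:R).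
  have [e [lte he]] : exists e, (e < 8)%N /\
    ((num k * 2 ^ (k * k) + w + opp k * h + 4 * opp k + e) %% 2 ^ lvl k)%N%:R
     <= (to_unit_square (line_point g a t)).2 * P
     < ((num k * 2 ^ (k * k) + w + opp k * h + 4 * opp k + e) %% 2 ^ lvl k)%N.+1%:R.
    apply: (@frac_hit R _ _ (b%:Z - (h + 4)%N%:Z)).
    rewrite intrB -!pmulrn /= mulrBl et -/P.
    rewrite (natrD _ (_ + opp k * h) (4 * opp k)) (natrD _ _ (opp k * h)).
    rewrite (natrM _ 4 (opp k)) (natrM _ (opp k) h) (natrD _ h 4) oppE hE.
    case/andP: th01 => th0 th1.
    move: hs; rewrite -/P; move: (_ * P) => y /andP[h1 h2].
    by apply/andP; split; lra.
  by exists e; split=> //; rewrite /coord2 eh addnA.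
have [e1 [lt1 h1]] := hit1; have [e2 [lt2 h2]] := hit2.
by exists g, A, w, e1, e2; split.
Qed.

End Kakeya.

(** * Segments in every direction *)

Section Segments.
Variable R : realType.

Lemma to_unit_squareP (x : R * R) : unit_square (to_unit_square x).
Proof.
split; rewrite /= intrN subr_ge0 ltrBlDl.
  by have := floor_itv x.1; rewrite intrD.
by have := floor_itv x.2; rewrite intrD.
Qed.

Lemma to_unit_square_translate (x : R * R) t :
  unit_square (translate x t) -> to_unit_square x = translate x t.
Proof.
move=> [h1 h2]; rewrite /to_unit_square /translate.
have fl (y : R) (m : int) : 0 <= y + m%:~R < 1 -> - Num.floor y = m.
  move=> /andP[l1 l2]; rewrite (@floor_def _ y (- m)) ?opprK //.
  by rewrite intrD intrN; apply/andP; split; lra.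
by rewrite (fl _ _ h1) (fl _ _ h2).
Qed.

Lemma line_point_succeeds (g : nat) (a t : R) : (g < 2)%N -> 0 <= a <= 1 -> 0 <= t ->
  succeeds (@kakeya_martingale R) (to_unit_square (line_point g a t)).
Proof.
move=> ltg a01 t0; apply: hit_succeeds; first exact: to_unit_squareP.
by move=> n; apply: line_point_hit.
Qed.

Lemma kakeya_segment (v : R * R) (L : R) : v <> (0, 0) -> 0 < L ->
  exists p q : R * R, [/\ segment_parallel p q v, L <= segment_length p q &
    forall x, segment p q x ->
      succeeds (@kakeya_martingale R) (to_unit_square x)].
Proof.
case: v => v1 v2 v0 L0.
have s0 : 0 < `|v1| + `|v2|.
  rewrite lt_neqAle eq_sym paddr_eq0 // !normr_eq0 addr_ge0 // andbT.
  by apply/negP => /andP[/eqP e1 /eqP e2]; apply: v0; rewrite e1 e2.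
set s := _ + _ in s0; pose a := `|v1| / s.
have a0 : 0 <= a by rewrite divr_ge0 // ltW.
have a1 : a <= 1 by rewrite ler_pdivrMr // mul1r lerDl.
have ea : 1 - a = `|v2| / s.
  by rewrite /a /s; field; rewrite gt_eqF.
(* Parallelism ignores the sign of [v]: [e] makes the second coordinate nonnegative, and [g] then
   records the sign of the first. *)
have [e [e2 ev]] : exists e : R, e ^+ 2 = 1 /\ e * v2 = `|v2|.
  by case: (ger0P v2) => h; [exists 1 | exists (-1)]; rewrite ?sqrrN expr1n ?mul1r ?mulN1r.
have [g [ltg eg]] : exists g, (g < 2)%N /\ (-1) ^+ g * `|v1| = e * v1.
  have h : e * v1 = `|v1| \/ e * v1 = - `|v1|.
    have : (e - 1) * (e + 1) = 0 by rewrite -subr_sqr expr1n e2 subrr.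
    move=> /eqP; rewrite mulf_eq0 subr_eq0 addr_eq0 => /orP[]/eqP->;
      case: (ger0P v1) => hv; rewrite ?mul1r ?mulN1r ?opprK; by [left | right].
  by case: h => ->; [exists 0%N | exists 1%N]; rewrite ?expr0 ?expr1 ?mul1r ?mulN1r.
have dir : (-1) ^+ g * a = e / s * v1 by rewrite /a mulrA eg mulrAC.
(* The direction [(+- a, 1 - a)] has Euclidean norm at least [1 / sqrt 2], so a parameter range of
   length [2 L] is enough. *)
exists (line_point g a 0), (line_point g a (2 * L)); split.
- exists (2 * L * e / s); rewrite /line_point /=; split.
    rewrite mulr0 sub0r -mulrBr.
    have -> : a * (2 * L) - beta a - - beta a = 2 * L * a by ring.
    by rewrite mulrCA dir; ring.
  have -> : 2 * L - (a * (2 * L) - beta a) - (0 - (a * 0 - beta a)) = 2 * L * (1 - a) by ring.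
  by rewrite ea -ev; ring.
- rewrite /segment_length /line_point /=; apply: le_trans (_ : Num.sqrt (L ^+ 2) <= _).
    by rewrite sqrtr_sqr ger0_norm // ltW.
  apply: ler_wsqrtr.
  have -> : ((-1) ^+ g * (a * (2 * L) - beta a) - (-1) ^+ g * (a * 0 - beta a)) =
    (-1) ^+ g * (2 * L * a) by ring.
  rewrite exprMn sqrr_sign mul1r.
  have -> : 2 * L - (a * (2 * L) - beta a) - (0 - (a * 0 - beta a)) = 2 * L * (1 - a) by ring.
  have -> : (2 * L * a) ^+ 2 + (2 * L * (1 - a)) ^+ 2 =
    L ^+ 2 + L ^+ 2 * (1 + 2 * (2 * a - 1) ^+ 2) by ring.
  by rewrite lerDl mulr_ge0 ?sqr_ge0 // addr_ge0 // mulr_ge0 // sqr_ge0.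
- move=> _ [tau /= /itvP tauI <-].
  rewrite (_ : (_, _) = line_point g a (2 * L * tau)).
    by apply: line_point_succeeds => //; rewrite ?a0 // !mulr_ge0 ?tauI // ltW.
  by rewrite /line_point /=; congr pair; ring.
Qed.

End Segments.

Theorem theorem11 (R : realType) :
  (exists K : set (R * R),
     ee_null K /\
     forall (v : R * R) (L : R), v <> (0, 0) -> 0 < L ->
       exists p q : R * R,
         [/\ segment_parallel p q v, L <= segment_length p q &
             segment p q `<=` K]) /\
  (forall (v : R * R) (L : R), v <> (0, 0) -> 0 < L ->
     exists p q : R * R,
       [/\ segment_parallel p q v, L <= segment_length p q &
           forall x : R * R, segment p q x -> ~ ee_random x]).
Proof.
have dP := @kakeya_martingaleP R; have dC := @kakeya_martingale_computable R.
split; last first.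
  move=> v L v0 L0; have [p [q [pv pL pK]]] := kakeya_segment v0 L0.
  exists p, q; split=> // x /pK dx; apply.
  by exists (@kakeya_martingale R).
exists [set x | succeeds (@kakeya_martingale R) (to_unit_square x)]; split.
  exists (@kakeya_martingale R); split=> // y [yU [t _ [x dx ex]]].
  by rewrite -ex in yU *; rewrite -to_unit_square_translate.
move=> v L v0 L0; have [p [q [pv pL pK]]] := kakeya_segment v0 L0.
by exists p, q.
Qed.
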